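(* Let $J\subset\mathbb{R}$ be an open interval containing $t_0$, let $N\ge 0$ be an integer, and let $$\mathrm{d}\mu(\theta;t)=\sum_{j=0}^{N}\gamma_j(t)\,\delta(\theta-\omega_j(t))$$ be a finite nonnegative measure on the unit circle parametrized by $z=e^{i\theta}$ and depending on a parameter $t$ varying in $J$. Suppose that $\gamma_j(t)$ and $\omega_j(t)$ are differentiable functions of $t$. Let $P(\cdot;t)$ be a nonconstant monic paraorthogonal polynomial on the unit circle (POPUC) of degree $n$ associated with $\mathrm{d}\mu(\theta;t)$. Assume that $P(\zeta_0;t_0)=0$. (1) There exist $\epsilon>0$ and $\delta>0$, and a unique function $\zeta:I_\epsilon(t_0)\to C_\delta(\zeta_0)$, differentiable on $I_\epsilon(t_0)$, with $\zeta(t_0)=\zeta_0$, and such that $P(\zeta(t);t)=0$ for each $t\in I_\epsilon(t_0)$. (2) Assume moreover that $P(e^{i\theta_0};t)=0$ for each $t\in I_\epsilon(t_0)$, with $\zeta_0\ne e^{i\theta_0}$. Denote the zeros of $P(\cdot;t)$ by $\zeta_k(t)=e^{i\varphi_k(t)}$ $(k=1,\dots,n)$, where we set $\theta_0=\varphi_{n-1}(t)$ and $\varphi(t)=\varphi_n(t)$, with $\zeta(t)=e^{i\varphi(t)}$, and define $$s(\theta;t)=\frac{\sin\left(\frac{\varphi(t)-\theta_0}{2}\right)}{2\sin\left(\frac{\varphi(t)-\theta}{2}\right)\sin\left(\frac{\theta_0-\theta}{2}\right)},\qquad S(\theta;t)=\sum_{k=1}^{n}\frac{1}{1+\delta_{k,n-1}+\delta_{k,n}}\cot\left(\frac{\varphi_k(t)-\theta}{2}\right).$$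 Then $\zeta(t)=e^{i\varphi(t)}$ moves strictly counterclockwise along $\mathbb{S}^1$ as $t$ increases on $I_\epsilon(t_0)$, provided that, for each $t\in I_\epsilon(t_0)$, $$W_j(t)=s(\omega_j(t);t)\,\frac{\mathrm{d}\gamma_j}{\mathrm{d}t}(t)-\gamma_j(t)\,s(\omega_j(t);t)\,S(\omega_j(t);t)\,\frac{\mathrm{d}\omega_j}{\mathrm{d}t}(t)$$ is nonnegative for all $j$ and nonzero for at least one value of $j$, and $\omega_j(t)\ne\varphi_k(t)$ for all $j,k$. Furthermore, if $W_j(t)=0$ for all $t\in I_\epsilon(t_0)$ and all $j$, then $\zeta(t)$ does not move as $t$ increases on $I_\epsilon(t_0)$.
   Context: Notation: $\mathbb{D}_r(c)$ is the open disk in $\mathbb{C}$ of radius $r>0$ centred at $c$; $\mathbb{S}^1$ is the unit circle; $C_r(c)=\mathbb{D}_r(c)\cap\mathbb{S}^1$; $I_r(c)=\mathbb{D}_r(c)\cap\mathbb{R}$ (for $I_\epsilon(t_0)$, $\epsilon$ is small enough that $I_\epsilon(t_0)\subset J$). $\delta(\theta-\omega)$ denotes the unit point mass at $e^{i\omega}$, and $\delta_{k,m}$ is the Kronecker delta. For each $t$ the mass points $e^{i\omega_0(t)},\dots,e^{i\omega_N(t)}$ are distinct, and the support of $\mathrm{d}\mu(\cdot;t)$ has at least $n$ points, so that the POPUC of degree $n$ exists. Orthogonal polynomials: $Q_m(z;t)=z^m+\cdots$ denotes the monic orthogonal polynomial of degree $m$ on the unit circle with respect to $\mathrm{d}\mu(\cdot;t)$,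 i.e. $\int Q_m(e^{i\theta};t)\overline{Q_l(e^{i\theta};t)}\,\mathrm{d}\mu(\theta;t)=0$ for $l\ne m$ and $\int|Q_m(e^{i\theta};t)|^2\mathrm{d}\mu(\theta;t)\ne 0$. If the measure consists of $M$ distinct point masses, these exist for degrees $0,\dots,M-1$. POPUC: the monic paraorthogonal polynomial of degree $n$ associated with $\mathrm{d}\mu(\cdot;t)$ and a paraorthogonality parameter $b(t)\in\mathbb{S}^1$ is $$P(z;t)=zQ_{n-1}(z;t)-\overline{b(t)}\,Q_{n-1}^*(z;t),\qquad Q_{n-1}^*(z;t)=z^{n-1}\overline{Q_{n-1}(1/\overline z;t)}.$$ All its zeros are simple and lie on $\mathbb{S}^1$. ''Moves strictly counterclockwise along $\mathbb{S}^1$ as $t$ increases'' means that the continuous argument $\varphi(t)$ of $\zeta(t)$ is strictly increasing in $t$; ''does not move'' means $\zeta(t)$ is constant. Arguments such as $\omega_j(t)$ and $\varphi_k(t)$ are compared modulo $2\pi$.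
   Formalization: In part (1) the paraorthogonality parameter b(t) is additionally assumed differentiable on J; without this the claim fails (for n=1, P=z-conj b(t), so the zero is conj b(t)). Part (2) does not assume it. *)

(* Defs.v *)
From HB Require Import structures.
From mathcomp Require Export all_boot all_order all_algebra.
From mathcomp Require Export all_classical all_reals all_analysis.
From mathcomp Require Export complex.

Set Implicit Arguments.
Unset Strict Implicit.
Unset Printing Implicit Defensive.

Export Order.TTheory GRing.Theory Num.Theory.
Export numFieldNormedType.Exports.

Local Open Scope classical_set_scope.
Local Open Scope complex_scope.
Local Open Scope ring_scope.

Definition expi (R : realType) (theta : R) : R[i] := cos theta +i* sin theta.

Definition cot (R : realType) (x : R) : R := cos x / sin x.

(* The library has no normed-module structure on R[i] over R, so [derivable]
   does not apply to a function R -> R[i]; this is the same difference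
   quotient, with limit taken in the complex norm. *)
Definition cderivable (R : realType) (f : R -> R[i]) (t : R) : Prop :=
  cvg ((fun h : R => (h^-1)%:C * (f (h + t) - f t) : R[i]^o) @ 0^').

Definition circle_arc (R : realType) (r : R) (c : R[i]) : set R[i] :=
  [set z | `|z - c| < r%:C /\ `|z| = 1].

(* The integral of f(e^{i theta}) against
   sum_j gamma_j delta(theta - omega_j). *)
Definition mass_integral (R : realType) (N : nat) (gamma omega : 'I_N.+1 -> R)
    (f : R[i] -> R[i]) : R[i] :=
  \sum_(j < N.+1) (gamma j)%:C * f (expi (omega j)).

Definition is_opuc (R : realType) (N : nat) (gamma omega : 'I_N.+1 -> R)
    (n : nat) (Q : nat -> {poly R[i]}) : Prop :=
  forall m, (m < n)%N ->
    [/\ Q m \is monic, size (Q m) = m.+1,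
        mass_integral gamma omega (fun z => `|(Q m).[z]| ^+ 2) != 0 &
        forall l, (l < n)%N -> l != m ->
          mass_integral gamma omega (fun z => (Q m).[z] * ((Q l).[z])^*) = 0].

(* The polynomial z^m * conj (q (1 / conj z)), for q of degree at most m;
   see [horner_revconj]. *)
Definition revconj (R : realType) (m : nat) (q : {poly R[i]}) : {poly R[i]} :=
  \poly_(i < m.+1) (q`_(m - i))^*.

Lemma horner_revconj (R : realType) (m : nat) (q : {poly R[i]}) (z : R[i]) :
  (size q <= m.+1)%N -> z != 0 ->
  (revconj m q).[z] = z ^+ m * (q.[(z^*)^-1])^*.
Proof.
move=> sq z0; rewrite horner_poly (horner_coef_wide _ sq) rmorph_sum big_distrr.
rewrite (reindex_inj rev_ord_inj) /=; apply: eq_bigr => i _.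
have le_im : (i <= m)%N by rewrite -ltnS.
rewrite subSS subKn // rmorphM rmorphXn fmorphV /= conjCK.
have -> : z ^+ m = z ^+ (m - i) * z ^+ i by rewrite -exprD subnK.
by rewrite exprVn mulrCA -mulrA divff ?mulr1 // expf_neq0.
Qed.

Definition is_popuc (R : realType) (N : nat) (gamma omega : 'I_N.+1 -> R)
    (n : nat) (b : R[i]) (P : {poly R[i]}) : Prop :=
  exists2 Q : nat -> {poly R[i]}, is_opuc gamma omega n Q &
    P = 'X * Q n.-1 - (b^*)%:P * revconj n.-1 (Q n.-1).

Definition zero_branch (R : realType) (J : set R) (P : R -> {poly R[i]})
    (t0 : R) (zeta0 : R[i]) (eps delta : R) (zeta : R -> R[i]) : Prop :=
  [/\ 0 < eps, 0 < delta, ball t0 eps `<=` J, zeta t0 = zeta0 &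
      forall t, ball t0 eps t ->
        [/\ circle_arc delta zeta0 (zeta t), cderivable zeta t &
            root (P t) (zeta t)]].

Definition s_weight (R : realType) (theta0 phi theta : R) : R :=
  sin ((phi - theta0) / 2) /
    (2 * sin ((phi - theta) / 2) * sin ((theta0 - theta) / 2)).

(* Zero arguments phi k are numbered from 1 to n: phi (n-1) belongs to the
   fixed zero and phi n to the moving one. *)
Definition S_weight (R : realType) (n : nat) (phi : nat -> R) (theta : R) : R :=
  \sum_(1 <= k < n.+1)
    (1 + (k == n.-1)%:R + (k == n)%:R)^-1 * cot ((phi k - theta) / 2).

Definition W_weight (R : realType) (n : nat) (theta0 : R) (phi : nat -> R -> R)
    (gammaj omegaj : R -> R) (t : R) : R :=
  let s := s_weight theta0 (phi n t) (omegaj t) in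
  let S := S_weight n (phi^~ t) (omegaj t) in
  s * derive1 gammaj t - gammaj t * s * S * derive1 omegaj t.

(* Main.v *)
Require Import Defs.
From mathcomp Require Import ring.

Set Implicit Arguments.
Unset Strict Implicit.
Unset Printing Implicit Defensive.
Local Open Scope classical_set_scope.
Local Open Scope complex_scope.
Local Open Scope ring_scope.

(** The argument rests on two consequences of orthogonality.  For a paraorthogonal
    polynomial P of degree n, the integral of P times the conjugate of z q
    vanishes for every q of degree at most n - 2 ([popuc_orthogonal]).  And if x
    and y = 1 / conj x are zeros in the sense that (z - x)(z - y) divides P, then
    testing against the cofactor S gives a multiple of the integral of
    |(z - x) S|^2, because (z - x)(z - y) conj z = - |z - x|^2 / conj x on the
    circle; this cannot vanish, as the measure has at least n masses
    ([popuc_simple]).  The zeros being symmetric under x -> 1 / conj x, they are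
    therefore simple and lie on the circle.

    Existence of the branch.  The coefficients of P are differentiable in t: an
    orthogonal polynomial solves a linear system whose matrix of moments is
    invertible and differentiable, so Cramer's rule applies
    ([cdiff_orthogonal_coef]).  A zero of P(t0) is then followed by elementary
    means.  Since |P(t)(x)| is the product of the distances from x to the zeros,
    a small value forces a zero close to x ([near_exists_root]).  Two nearby
    zeros y and z would annihilate the divided difference of P(t) at y and z,
    which stays near the derivative of P(t0) at its simple zero
    ([near_unique_root]).  The same divided difference turns the difference
    quotient of P into that of the zero ([cdiff_root]).

    Motion.  Let a = exp(i theta0) be the fixed zero, zeta the moving one and G
    the product of the remaining factors.  On the circle,
    (z - zeta)(z - a) conj z is a constant times the real kernel
    K = sin((phi - theta)/2) sin((theta0 - theta)/2) ([chord_product]), so that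
    the sum of gamma_j K_j G(z_j) conj(q(z_j)) vanishes for all q of degree at
    most n - 2.  Let h(s) be the sum of gamma_j(s) K_j(s) |G_t(z_j(s))|^2 with the
    polynomial G_t kept at its value at time t.  Replacing one factor G_t by G_s
    gives zero identically in s, and the error is a sum of products of two
    functions which both vanish at s = t.  Hence h'(t) = 0
    ([is_derive_frozen_sum]).  Freezing G_t avoids differentiating the other zeros,
    whose labelling may jump as t varies.  Writing h'(t) = 0 out and multiplying
    by sin((phi - theta0)/2) gives
      phi'(t) * (positive) = sum_j (positive) * W_j(t)
    ([velocity_formula]), from which both statements about the motion follow by
    the mean value theorem. *)

(** * Differentiation of complex-valued functions of a real variable *)

(** Splitting into real and imaginary parts makes the rules of the real calculus
    available; [is_cderive_quotP] relates this to difference quotients. *)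
Definition is_cderive (R : realType) (f : R -> R[i]) (t : R) (l : R[i]) :=
  is_derive t 1 (fun x => complex.Re (f x)) (complex.Re l) /\
  is_derive t 1 (fun x => complex.Im (f x)) (complex.Im l).

Section Limits.
Context {R : realType} {T : Type} {F : set_system T} {FF : Filter F}.

Lemma norm_le_ReIm (z : R[i]) : `|z| <= (`|complex.Re z| + `|complex.Im z|)%:C.
Proof.
rewrite normc_def lecR -(@ler_pXn2r _ 2) ?nnegrE ?sqrtr_ge0 ?addr_ge0 //.
rewrite sqr_sqrtr ?addr_ge0 ?sqr_ge0 // sqrrD !real_normK ?num_real //.
by rewrite lerD2r lerDl mulrn_wge0 // mulr_ge0.
Qed.

Lemma norm_ge_Im (z : R[i]) : `|complex.Im z|%:C <= `|z|.
Proof.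
case: z => a b; rewrite normc_def lecR /= -(@ler_pXn2r _ 2) ?nnegrE ?sqrtr_ge0 //.
by rewrite sqr_sqrtr ?addr_ge0 ?sqr_ge0 // real_normK ?num_real // lerDr sqr_ge0.
Qed.

Lemma ReB (x y : R[i]) : complex.Re (x - y) = complex.Re x - complex.Re y.
Proof. by case: x; case: y. Qed.
Lemma ImB (x y : R[i]) : complex.Im (x - y) = complex.Im x - complex.Im y.
Proof. by case: x; case: y. Qed.

(** The complex norm lies between each of |Re|, |Im| and their sum. *)
Lemma cvg_ReIm (f : T -> R[i]^o) (l : R[i]^o) :
  f @ F --> l <->
  (fun x => complex.Re (f x)) @ F --> complex.Re l /\
  (fun x => complex.Im (f x)) @ F --> complex.Im l.
Proof.
split=> [|[]].
  move/cvgrPdist_lt => fl; split; apply/cvgrPdist_lt => e e0.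
  - near=> x; rewrite -ltcR -ReB; apply: le_lt_trans (normc_ge_Re _) _.
    by near: x; apply: fl; rewrite ltcR.
  - near=> x; rewrite -ltcR -ImB; apply: le_lt_trans (norm_ge_Im _) _.
    by near: x; apply: fl; rewrite ltcR.
move/cvgrPdist_lt => fr /cvgrPdist_lt fi; apply/cvgrPdist_lt => e e0.
have [r er r0] : exists2 r : R, e = r%:C & 0 < r.
  have /complex_realP[r er] := gtr0_real e0.
  by exists r => //; rewrite -ltcR -er.
near=> x; apply: le_lt_trans (norm_le_ReIm _) _.
rewrite er ltcR ReB ImB (splitr r).
apply: ltrD; near: x; [apply: fr|apply: fi]; exact: divr_gt0.
Unshelve. all: by end_near. Qed.
End Limits.

Section Deriv.
Variable R : realType.
Implicit Types (f g : R -> R[i]) (t : R).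

Lemma Re_realM (a : R) (z : R[i]) : complex.Re (a%:C * z) = a * complex.Re z.
Proof. by case: z => x y /=; rewrite mul0r subr0. Qed.
Lemma Im_realM (a : R) (z : R[i]) : complex.Im (a%:C * z) = a * complex.Im z.
Proof. by case: z => x y /=; rewrite mul0r addr0. Qed.

Lemma is_derive_quotP (f : R -> R) t l :
  is_derive t 1 f l <-> (fun h => h^-1 * (f (h + t) - f t)) @ 0^' --> l.
Proof.
split.
  move=> [fd fl]; rewrite -fl; move: fd; rewrite /derivable /derive.
  under eq_fun do rewrite [_%:A]mulr1.
  by [].
move=> fl.
have fd : derivable f t 1.
  rewrite /derivable.
  under eq_fun do rewrite [_%:A]mulr1.
  by apply/cvg_ex; exists l.
apply: DeriveDef => //; rewrite /derive.
under eq_fun do rewrite [_%:A]mulr1.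
exact/cvg_lim.
Qed.

Lemma is_cderive_quotP f t l : is_cderive f t l <->
  (fun h : R => (h^-1)%:C * (f (h + t) - f t) : R[i]^o) @ 0^' --> (l : R[i]^o).
Proof.
rewrite cvg_ReIm /is_cderive !is_derive_quotP.
under [X in _ <-> X @ _ --> _ /\ _]eq_fun do rewrite Re_realM ReB.
under [X in _ <-> _ /\ X @ _ --> _]eq_fun do rewrite Im_realM ImB.
by [].
Qed.

Lemma cderivableP f t : cderivable f t <-> exists l, is_cderive f t l.
Proof.
split=> [|[l /is_cderive_quotP fl]]; last by apply/cvg_ex; exists l.
by move=> /cvg_ex[l fl]; exists l; apply/is_cderive_quotP.
Qed.
End Deriv.

Section Rules.
Variable R : realType.
Implicit Types (f g : R -> R[i]) (t : R).

Lemma is_cderive_cst (c : R[i]) t : is_cderive (fun=> c) t 0.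
Proof. by split; exact: is_derive_cst. Qed.

Lemma ReD (x y : R[i]) : complex.Re (x + y) = complex.Re x + complex.Re y.
Proof. by case: x; case: y. Qed.
Lemma ImD (x y : R[i]) : complex.Im (x + y) = complex.Im x + complex.Im y.
Proof. by case: x; case: y. Qed.
Lemma ReM (x y : R[i]) : complex.Re (x * y) =
  complex.Re x * complex.Re y - complex.Im x * complex.Im y.
Proof. by case: x; case: y. Qed.
Lemma ImM (x y : R[i]) : complex.Im (x * y) =
  complex.Re x * complex.Im y + complex.Im x * complex.Re y.
Proof. by case: x => a b; case: y => c d; rewrite /= [b * c]mulrC. Qed.

Lemma is_cderive_eq f t a b : is_cderive f t a -> a = b -> is_cderive f t b.
Proof. by move=> fa <-. Qed.

Lemma is_cderiveD f g t a b : is_cderive f t a -> is_cderive g t b ->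
  is_cderive (fun x => f x + g x) t (a + b).
Proof.
move=> [fr fi] [gr gi]; split; rewrite (ReD, ImD).
  by under eq_fun do rewrite ReD; exact: is_deriveD.
by under eq_fun do rewrite ImD; exact: is_deriveD.
Qed.

Lemma is_cderiveM f g t a b : is_cderive f t a -> is_cderive g t b ->
  is_cderive (fun x => f x * g x) t (f t * b + a * g t).
Proof.
move=> [fr fi] [gr gi]; split; rewrite (ReD, ImD) !(ReM, ImM).
  under eq_fun do rewrite ReM.
  have := is_deriveB (is_deriveM fr gr) (is_deriveM fi gi).
  move/is_derive_eq; apply; rewrite /GRing.scale /=; ring.
under eq_fun do rewrite ImM.
have := is_deriveD (is_deriveM fr gi) (is_deriveM fi gr).
move/is_derive_eq; apply; rewrite /GRing.scale /=; ring.
Qed.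

Lemma is_cderive_real (f : R -> R) t a : is_derive t 1 f a ->
  is_cderive (fun x => (f x)%:C) t a%:C.
Proof. by move=> fa; split => //=; exact: is_derive_cst. Qed.

Lemma is_cderive_conj f t a : is_cderive f t a ->
  is_cderive (fun x => (f x)^*) t a^*.
Proof.
move=> [fr fi]; split.
  rewrite (_ : complex.Re _ = complex.Re a); last by case: (a).
  rewrite (_ : (fun _ => _) = fun x => complex.Re (f x)) //.
  by apply/funext => x; case: (f x).
rewrite (_ : complex.Im _ = - complex.Im a); last by case: (a).
rewrite (_ : (fun _ => _) = fun x => - complex.Im (f x)); first exact: is_deriveN.
by apply/funext => x; case: (f x).
Qed.

Lemma near_eq_is_cderive f g t a : {near nbhs t, f =1 g} ->
  is_cderive f t a -> is_cderive g t a.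
Proof.
move=> fg [fr fi]; split; [apply: near_eq_is_derive fr|apply: near_eq_is_derive fi].
  by apply: filterS fg => x ->.
by apply: filterS fg => x ->.
Qed.

Lemma is_cderive_cvg f t a : is_cderive f t a ->
  (f : R -> R[i]^o) @ t --> (f t : R[i]^o).
Proof.
move=> [fr fi]; apply/cvg_ReIm; split;
  apply/differentiable_continuous/derivable1_diffP; exact: ex_derive.
Qed.

Lemma is_cderive_sum0 (I : Type) (r : seq I) (F : I -> R -> R[i]) t :
  (forall i, is_cderive (F i) t 0) ->
  is_cderive (fun x => \sum_(i <- r) F i x) t 0.
Proof.
move=> F0; elim: r => [|i r IH].
  by under eq_fun do rewrite big_nil; exact: is_cderive_cst.
under eq_fun do rewrite big_cons.
by apply: is_cderive_eq (is_cderiveD (F0 i) IH) _; rewrite addr0.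
Qed.

Definition cdiff f t := exists l, is_cderive f t l.

Lemma cdiff_cst (c : R[i]) t : cdiff (fun=> c) t.
Proof. by exists 0; exact: is_cderive_cst. Qed.
Lemma cdiffD f g t : cdiff f t -> cdiff g t -> cdiff (fun x => f x + g x) t.
Proof. by move=> [a fa] [b gb]; exists (a + b); exact: is_cderiveD. Qed.
Lemma cdiffM f g t : cdiff f t -> cdiff g t -> cdiff (fun x => f x * g x) t.
Proof. by move=> [a fa] [b gb]; exists (f t * b + a * g t); exact: is_cderiveM. Qed.
Lemma cdiffN f t : cdiff f t -> cdiff (fun x => - f x) t.
Proof.
move=> fd; under eq_fun do rewrite -mulN1r; apply: cdiffM fd; exact: cdiff_cst.
Qed.
Lemma cdiffB f g t : cdiff f t -> cdiff g t -> cdiff (fun x => f x - g x) t.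
Proof. by move=> fd gd; apply: cdiffD => //; exact: cdiffN. Qed.
Lemma cdiff_conj f t : cdiff f t -> cdiff (fun x => (f x)^*) t.
Proof. by move=> [a fa]; exists a^*; exact: is_cderive_conj. Qed.
Lemma cdiff_real (f : R -> R) t : derivable f t 1 -> cdiff (fun x => (f x)%:C) t.
Proof.
by move=> fd; exists ('D_1 f t)%:C; apply: is_cderive_real; exact: derivableP.
Qed.
Lemma cdiff_expi (f : R -> R) t : derivable f t 1 ->
  cdiff (fun x => expi (f x)) t.
Proof.
move=> /derivableP fd; have dcos := is_derive1_comp (is_derive_cos (f t)) fd.
have dsin := is_derive1_comp (is_derive_sin (f t)) fd.
by exists ((- sin (f t) * 'D_1 f t) +i* (cos (f t) * 'D_1 f t)).
Qed.
Lemma cdiffX f t n : cdiff f t -> cdiff (fun x => f x ^+ n) t.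
Proof.
move=> fd; elim: n => [|n IH]; first exact: cdiff_cst.
by under eq_fun do rewrite exprS; exact: cdiffM.
Qed.
Lemma cdiff_sum (I : Type) (r : seq I) (P : pred I) (F : I -> R -> R[i]) t :
  (forall i, P i -> cdiff (F i) t) -> cdiff (fun x => \sum_(i <- r | P i) F i x) t.
Proof.
move=> Fd; elim: r => [|i r IH].
  by under eq_fun do rewrite big_nil; exact: cdiff_cst.
under eq_fun do rewrite big_cons; case Pi: (P i) => //.
by apply: cdiffD IH; exact: Fd.
Qed.
Lemma cdiff_prod (I : Type) (r : seq I) (P : pred I) (F : I -> R -> R[i]) t :
  (forall i, P i -> cdiff (F i) t) -> cdiff (fun x => \prod_(i <- r | P i) F i x) t.
Proof.
move=> Fd; elim: r => [|i r IH].
  by under eq_fun do rewrite big_nil; exact: cdiff_cst.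
under eq_fun do rewrite big_cons; case Pi: (P i) => //.
by apply: cdiffM IH; exact: Fd.
Qed.
Lemma near_cdiff f g t : {near nbhs t, f =1 g} -> cdiff f t -> cdiff g t.
Proof. by move=> fg [a fa]; exists a; exact: near_eq_is_cderive fa. Qed.
Lemma cdiff_cvg f t : cdiff f t -> (f : R -> R[i]^o) @ t --> (f t : R[i]^o).
Proof. by move=> [a]; exact: is_cderive_cvg. Qed.

Lemma cvg_neq0 {T : Type} {F : set_system T} {FF : Filter F}
    (f : T -> R[i]^o) (l : R[i]^o) :
  l != 0 -> f @ F --> l -> \forall x \near F, f x != 0.
Proof.
move=> l0 /cvgrPdist_lt fl; near=> x; apply/eqP => fx0.
have : `|l - f x| < `|l| by near: x; apply: fl; rewrite normr_gt0.
by rewrite fx0 subr0 ltxx.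
Unshelve. all: by end_near. Qed.

(** From 1 / z = conj z / |z|^2, where |z|^2 is a real function. *)
Lemma cdiffV f t : f t != 0 -> cdiff f t -> cdiff (fun x => (f x)^-1) t.
Proof.
move=> ft0 fd.
pose nf x := complex.Re (f x * (f x)^*).
have nfE x : (nf x)%:C = f x * (f x)^*.
  by apply: RRe_real; rewrite ger0_real // mul_conjC_ge0.
have nf0 : nf t != 0.
  by rewrite -(inj_eq (@complexI R)) nfE mulf_neq0 // conjC_eq0.
have nfd : derivable nf t 1.
  have [l [lr _]] := cdiffM fd (cdiff_conj fd); exact: ex_derive.
have := cdiffM (cdiff_conj fd) (cdiff_real (derivableV nf0 nfd)).
apply: near_cdiff; have := cdiff_cvg fd => /(cvg_neq0 ft0).
apply: filterS => x fx0; rewrite fmorphV /= nfE invfM mulrCA divff ?mulr1 //.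
by rewrite conjC_eq0.
Qed.
End Rules.

(** * Orthogonal and paraorthogonal polynomials *)

Section Circle.
Variable R : realType.
Implicit Types (x y : R) (z : R[i]).

Lemma norm_expi x : `|expi x| = 1.
Proof. by rewrite /expi normc_def /= cos2Dsin2 sqrtr1. Qed.

Lemma expi_neq0 x : expi x != 0.
Proof. by rewrite -normr_eq0 norm_expi oner_eq0. Qed.

Lemma unit_mulJ z : `|z| = 1 -> z * z^* = 1.
Proof. by move=> z1; rewrite -normCK z1 expr1n. Qed.

Lemma unit_conj z : `|z| = 1 -> z^* = z^-1.
Proof.
move=> z1; have z0 : z != 0 by rewrite -normr_eq0 z1 oner_eq0.
by apply: (mulfI z0); rewrite unit_mulJ // divff.
Qed.
End Circle.

Section Masses.
Variables (R : realType) (N : nat).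

Lemma poly_eq0_masses (n : nat) (A : pred 'I_N) (z : 'I_N -> R[i])
    (d : {poly R[i]}) :
  injective z -> (n <= #|A|)%N -> (size d <= n)%N ->
  (forall j, A j -> root d (z j)) -> d = 0.
Proof.
move=> inj nA sd rd.
apply: (@roots_geq_poly_eq0 _ d [seq z j | j <- enum A]).
- by apply/allP => _ /mapP[j + ->]; rewrite mem_enum; exact: rd.
- by rewrite map_inj_uniq // enum_uniq.
by rewrite size_map -cardE (leq_trans sd).
Qed.

Lemma Re_sum (I : Type) (r : seq I) (F : I -> R[i]) :
  complex.Re (\sum_(i <- r) F i) = \sum_(i <- r) complex.Re (F i).
Proof. by apply: (big_morph _ (@ReD R)). Qed.

(** Invertibility of a moment matrix, phrased for polynomials.  Combining the
    equations with the conjugate coefficients of d gives that the sum of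
    w_j |d(z_j)|^2 is zero, and its real part has only nonnegative terms.
    Complex weights are needed for (1 - a conj z) dmu, which arises when a fixed
    zero a is divided out. *)
Lemma moments_nondegenerate (m : nat) (A : pred 'I_N) (w z : 'I_N -> R[i])
    (d : {poly R[i]}) :
  injective z -> (m <= #|A|)%N -> (size d <= m)%N ->
  (forall j, 0 <= complex.Re (w j)) -> (forall j, A j -> 0 < complex.Re (w j)) ->
  (forall k, (k < m)%N -> \sum_j w j * d.[z j] * (z j ^+ k)^* = 0) -> d = 0.
Proof.
move=> inj mA sd w0 wA dz; apply: (poly_eq0_masses inj mA sd) => j Aj.
pose r i := complex.Re (`|d.[z i]| ^+ 2).
have rE i : (r i)%:C = `|d.[z i]| ^+ 2.
  by apply: RRe_real; rewrite ger0_real // exprn_ge0.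
have r0 i : 0 <= r i by rewrite -ler0c rE exprn_ge0.
have : \sum_i complex.Re (w i) * r i = 0.
  transitivity (complex.Re (\sum_(k < m) (d`_k)^* *
      \sum_i w i * d.[z i] * (z i ^+ k)^*)).
    under [in RHS]eq_bigr do rewrite big_distrr /=.
    rewrite exchange_big Re_sum; apply: eq_bigr => i _ /=.
    have -> : \sum_(k < m) (d`_k)^* * (w i * d.[z i] * (z i ^+ k)^*) = w i * (r i)%:C.
      rewrite rE normCK mulrA [in X in _ = _ * X](horner_coef_wide _ sd).
      rewrite rmorph_sum big_distrr; apply: eq_bigr => k _ /=.
      by rewrite rmorphM /=; ring.
    by rewrite [w i * _]mulrC Re_realM mulrC.
  by rewrite big1 // => k _; rewrite dz ?mulr0.
move/eqP; rewrite psumr_eq0 => [|i _]; last exact: mulr_ge0.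
move=> /allP/(_ j (mem_index_enum _)); rewrite mulf_eq0 gt_eqF ?wA //=.
by rewrite -(inj_eq (@complexI R)) rE expf_eq0 normr_eq0.
Qed.
End Masses.

Section Opuc.
Variable R : realType.
Variables (N : nat) (gamma omega : 'I_N.+1 -> R).
Local Notation mint := (mass_integral gamma omega).
Local Notation z j := (expi (omega j)).

Lemma eq_mint (f g : R[i] -> R[i]) : (forall z : R[i], `|z| = 1 -> f z = g z) ->
  mint f = mint g.
Proof. by move=> fg; apply: eq_bigr => j _; rewrite fg // norm_expi. Qed.

Lemma mintD (f g : R[i] -> R[i]) : mint (fun z => f z + g z) = mint f + mint g.
Proof. by rewrite -big_split /=; apply: eq_bigr => j _; rewrite mulrDr. Qed.

Lemma mintZ c (f : R[i] -> R[i]) : mint (fun z => c * f z) = c * mint f.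
Proof. by rewrite big_distrr; apply: eq_bigr => j _; rewrite mulrCA. Qed.

Lemma mint0 : mint (fun=> 0) = 0.
Proof. by apply: big1 => j _; rewrite mulr0. Qed.

Lemma mint_conj (f : R[i] -> R[i]) : mint (fun z => (f z)^*) = (mint f)^*.
Proof.
rewrite rmorph_sum; apply: eq_bigr => j _; rewrite rmorphM; congr (_ * _).
by apply/esym/conj_Creal/complex_realP; exists (gamma j).
Qed.

(** Q_0, ..., Q_(m-1) are monic of all degrees below m, hence span the
    polynomials of degree less than m. *)
Lemma opuc_orthogonal n Q m (q : {poly R[i]}) : is_opuc gamma omega n Q ->
  (m < n)%N -> (size q <= m)%N -> mint (fun z => (Q m).[z] * (q.[z])^*) = 0.
Proof.
move=> opQ mn; suff H k : (k <= m)%N -> forall q : {poly R[i]}, (size q <= k)%N ->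
  mint (fun z => (Q m).[z] * (q.[z])^*) = 0 by exact: (H m).
elim: k => [_ p|k IH km p sp].
  rewrite leqn0 size_poly_eq0 => /eqP->.
  by rewrite -mint0; apply: eq_mint => w _; rewrite horner0 conjC0 mulr0.
have kn : (k < n)%N by exact: ltn_trans mn.
have [Qmon Qs _ _] := opQ k kn.
pose r := p - p`_k *: Q k.
have sr : (size r <= k)%N.
  apply/leq_sizeP => i; rewrite leq_eqVlt => /orP[/eqP<-|ki].
    have : (Q k)`_k = 1 by move/monicP: Qmon; rewrite lead_coefE Qs.
    by rewrite /r coefB coefZ => ->; rewrite mulr1 subrr.
  rewrite /r coefB coefZ [p`_i]nth_default ?(leq_trans sp) //.
    by rewrite [(Q k)`_i]nth_default ?Qs // mulr0 subrr.
have -> : p = p`_k *: Q k + r by rewrite /r addrC subrK.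
under eq_mint => w _ do rewrite hornerD hornerZ rmorphD rmorphM mulrDr mulrCA.
rewrite mintD mintZ (IH (ltnW km) _ sr).
have [_ _ _ ->] // := opQ m mn; first by rewrite mulr0 addr0.
by rewrite neq_ltn km.
Qed.

(** The term z Q is orthogonal to z q because Q is orthogonal to q, and Q^*
    because on the circle Q^* conj(z q) is the conjugate of Q conj(q'), with q'
    the reversed polynomial of q. *)
Lemma popuc_orthogonal n b P (q : {poly R[i]}) : is_popuc gamma omega n b P ->
  (0 < n)%N -> (size q <= n.-1)%N -> mint (fun z => P.[z] * (z * q.[z])^*) = 0.
Proof.
case: n => // m [Q opQ ->] _ /= sq.
have [_ Qs _ _] := opQ m (ltnSn m).
case: m => [|m] in Q opQ sq Qs *.
  move: sq; rewrite leqn0 size_poly_eq0 => /eqP->.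
  by rewrite -mint0; apply: eq_mint => w _; rewrite horner0 mulr0 conjC0 mulr0.
pose q' := revconj m q.
have sq' : (size q' <= m.+1)%N by exact: size_poly.
have -> : mint (fun z =>
    ('X * Q m.+1 - (b^*)%:P * revconj m.+1 (Q m.+1)).[z] * (z * q.[z])^*) =
  mint (fun z => (Q m.+1).[z] * (q.[z])^*) +
  (- b^*) * mint (fun z => ((Q m.+1).[z] * (q'.[z])^*)^*).
  rewrite -mintZ -mintD; apply: eq_mint => w w1.
  have w0 : w != 0 by rewrite -normr_eq0 w1 oner_eq0.
  rewrite hornerD hornerN !hornerM hornerX hornerC !horner_revconj ?Qs //.
  rewrite !rmorphM /= !conjCK (unit_conj w1) invrK mulrDl.
  congr (_ + _); first by rewrite mulrACA divff // mul1r.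
  by rewrite -!mulNr exprS; field.
by rewrite mint_conj !(opuc_orthogonal opQ) // conjC0 mulr0 addr0.
Qed.

Lemma popuc_monic n b P : is_popuc gamma omega n b P -> (0 < n)%N ->
  P \is monic /\ size P = n.+1.
Proof.
case: n => // m [Q opQ ->] _ /=.
have [Qmon Qs _ _] := opQ m (ltnSn m).
have sXQ : size ('X * Q m) = m.+2.
  by rewrite size_monicM ?monicX ?size_polyX ?Qs // -size_poly_eq0 Qs.
have sr : (size (- ((b^*)%:P * revconj m (Q m)))%R < size ('X * Q m)%R)%N.
  rewrite sXQ size_polyN mul_polyC ltnS (leq_trans (size_scale_leq _ _)) //.
  exact: size_poly.
split; last by rewrite size_polyDl.
by rewrite monicE lead_coefDl // lead_coefM lead_coefX mul1r; apply: Qmon.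
Qed.

Lemma popuc_root_neq0 n b P : is_popuc gamma omega n b P -> (0 < n)%N ->
  `|b| = 1 -> ~~ root P 0.
Proof.
case: n => // m [Q opQ ->] _ /= b1.
have [Qmon Qs _ _] := opQ m (ltnSn m).
rewrite /root hornerD hornerN !hornerM hornerX mul0r add0r oppr_eq0 hornerC.
rewrite horner_coef0 coef_poly /= subn0.
move/monicP: Qmon; rewrite lead_coefE Qs /= => ->.
by rewrite conjC1 mulr1 conjC_eq0 -normr_eq0 b1 oner_eq0.
Qed.

(** P is self-reciprocal up to a unimodular factor: P^* = - b P. *)
Lemma popuc_root_inv n b P x : is_popuc gamma omega n b P -> (0 < n)%N ->
  `|b| = 1 -> root P x -> root P (x^*)^-1.
Proof.
move=> popP n0 b1 Px.
have x0 : x != 0.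
  by apply: contraTneq Px => ->; exact: popuc_root_neq0 popP n0 b1.
case: n n0 popP => // m _ [Q opQ PE]; move: Px; rewrite {}PE /=.
have [Qmon Qs _ _] := opQ m (ltnSn m).
have y0 : (x^*)^-1 != 0 by rewrite invr_eq0 conjC_eq0.
have xc0 : x^* != 0 by rewrite conjC_eq0.
rewrite /root !hornerD !hornerN !hornerM !hornerX !hornerC !horner_revconj ?Qs //.
rewrite fmorphV /= conjCK invrK => /eqP/(congr1 Num.conj).
set y := (x^*)^-1; set A := _.[x]; set B := _.[y].
rewrite rmorphB !rmorphM rmorphXn conjC0 /= !conjCK => /eqP.
rewrite subr_eq0 => /eqP E.
have {E} E : A^* = y * (b * (x^* ^+ m * B)) by rewrite -E mulrA mulVf ?mul1r.
rewrite {}E.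
rewrite subr_eq0; apply/eqP.
have bb : b^* * b = 1 by rewrite mulrC -normCK b1 expr1n.
have yx : y ^+ m * x^* ^+ m = 1 by rewrite -exprMn mulVf ?expr1n.
transitivity ((b^* * b) * (y ^+ m * x^* ^+ m) * (y * B)); last by ring.
by rewrite bb yx !mul1r.
Qed.

(** If P = (z - x)(z - y) S with y = 1 / conj x, then P conj(z S) equals
    - |(z - x) S|^2 / conj x on the circle, so (z - x) S, of degree n - 1, would
    vanish at n points.  For |x| = 1 this excludes a double zero, for other x a
    pair of zeros symmetric in the circle. *)
Lemma popuc_simple n b P (x : R[i]) : (forall j, 0 <= gamma j) ->
  injective (fun j => z j) -> (n <= #|[pred j | (0 < gamma j)%R]|)%N ->
  (0 < n)%N -> is_popuc gamma omega n b P -> x != 0 ->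
  ~~ (('X - x%:P) * ('X - ((x^*)^-1)%:P) %| P).
Proof.
move=> g0 inj nA n0 popP x0; apply/negP => /dvdpP[S PE].
have [Pmon Ps] := popuc_monic popP n0.
have S0 : S != 0.
  by apply: contra_eq_neq Ps => S0; rewrite PE S0 mul0r size_poly0.
have sS : (size S).+1 = n.
  apply: succn_inj; rewrite -Ps PE size_Mmonic ?monicMl ?monicXsubC //.
  rewrite size_Mmonic ?monicXsubC ?monic_neq0 ?monicXsubC //.
  by rewrite !size_XsubC /= !addnS addn0.
have /(popuc_orthogonal popP n0) : (size S <= n.-1)%N by rewrite -sS.
have -> : mint (fun z => P.[z] * (z * S.[z])^*) =
   - (x^*)^-1 * mint (fun z => `|(('X - x%:P) * S).[z]| ^+ 2).
  rewrite -mintZ; apply: eq_mint => w w1.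
  have w0 : w != 0 by rewrite -normr_eq0 w1 oner_eq0.
  have xc0 : x^* != 0 by rewrite conjC_eq0.
  rewrite normCK PE !hornerM !hornerXsubC !rmorphM rmorphB /= (unit_conj w1).
  by field; apply/andP.
move/eqP; rewrite mulf_eq0 oppr_eq0 invr_eq0 conjC_eq0 (negPf x0) /=.
rewrite psumr_eq0 => [/allP H|j _]; last by rewrite mulr_ge0 ?exprn_ge0 // ler0c.
have : ('X - x%:P) * S = 0.
  apply: (poly_eq0_masses inj nA) => [|j gj].
    by rewrite size_monicM ?monicXsubC // size_XsubC -sS.
  have := H j (mem_index_enum _); rewrite mulf_eq0 expf_eq0 normr_eq0 /=.
  by rewrite (inj_eq (@complexI R) (gamma j) 0) gt_eqF.
by move/eqP; rewrite mulf_eq0 (negPf S0) orbF polyXsubC_eq0.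
Qed.
End Opuc.

(** * Differentiability of the coefficients *)

Section Gram.
Variable R : realType.

Lemma cdiff_det n (A : R -> 'M[R[i]]_n) t :
  (forall i j, cdiff (fun s => A s i j) t) -> cdiff (fun s => \det (A s)) t.
Proof.
move=> Ad; rewrite /determinant; apply: cdiff_sum => p _.
by apply: cdiffM; [exact: cdiff_cst|apply: cdiff_prod].
Qed.

Lemma cdiff_invmx n (A : R -> 'M[R[i]]_n) t : A t \in unitmx ->
  (forall i j, cdiff (fun s => A s i j) t) ->
  forall i j, cdiff (fun s => invmx (A s) i j) t.
Proof.
move=> At Ad i j; have dd := cdiff_det Ad.
have dt0 : \det (A t) != 0 by rewrite unitmxE unitfE in At.
have := cdiff_cvg dd => /(cvg_neq0 dt0) dn0.
have : cdiff (fun s => (\det (A s))^-1 *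
    ((-1) ^+ (j + i) * \det (row' j (col' i (A s))))) t.
  apply: cdiffM; first exact: cdiffV.
  apply: cdiffM; first exact: cdiff_cst.
  apply: cdiff_det => k l.
  by under eq_fun do rewrite !mxE; exact: Ad.
apply: near_cdiff; apply: filterS dn0 => s ds0.
by rewrite /invmx unitmxE unitfE ds0 !mxE /cofactor.
Qed.

(** The m lower coefficients of q s solve a square linear system in the moments
    of the weights w; nondegeneracy at t makes its matrix invertible near t. *)
Lemma cdiff_orthogonal_coef (N m : nat) (w z : 'I_N -> R -> R[i])
    (q : R -> {poly R[i]}) (t : R) :
  (forall j, cdiff (w j) t) -> (forall j, cdiff (z j) t) ->
  (\forall s \near t, [/\ q s \is monic, size (q s) = m.+1 &
     forall k, (k < m)%N ->
       \sum_j w j s * (q s).[z j s] * (z j s ^+ k)^* = 0]) ->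
  (forall d : {poly R[i]}, (size d <= m)%N ->
     (forall k, (k < m)%N ->
        \sum_j w j t * d.[z j t] * (z j t ^+ k)^* = 0) -> d = 0) ->
  forall i, cdiff (fun s => (q s)`_i) t.
Proof.
move=> wd zd qs nondeg.
pose A s : 'M[R[i]]_m := \matrix_(i, k) \sum_j w j s * z j s ^+ i * (z j s ^+ k)^*.
pose B s : 'rV[R[i]]_m := \row_k - \sum_j w j s * z j s ^+ m * (z j s ^+ k)^*.
have Ad i k : cdiff (fun s => A s i k) t.
  under eq_fun do rewrite mxE.
  apply: cdiff_sum => j _; apply: cdiffM; last by apply: cdiff_conj; exact: cdiffX.
  by apply: cdiffM => //; exact: cdiffX.
have Bd i k : cdiff (fun s => B s i k) t.
  under eq_fun do rewrite mxE.
  apply/cdiffN/cdiff_sum => j _; apply: cdiffM; last by apply: cdiff_conj; exact: cdiffX.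
  by apply: cdiffM => //; exact: cdiffX.
have mulA s (u : 'rV[R[i]]_m) k : (u *m A s) 0 k =
    \sum_j w j s * (rVpoly u).[z j s] * (z j s ^+ k)^*.
  rewrite mxE; under eq_bigr do rewrite mxE big_distrr /=.
  rewrite exchange_big; apply: eq_bigr => j _.
  rewrite (horner_coef_wide _ (size_poly _ _)) big_distrr big_distrl /=.
  apply: eq_bigr => i _; rewrite coef_rVpoly_ord; ring.
have At : A t \in unitmx.
  rewrite -row_free_unit; apply: inj_row_free => u uA.
  apply/(can_inj rVpolyK); rewrite linear0; apply: nondeg; first exact: size_poly.
  by move=> k km; have := mulA t u (Ordinal km); rewrite uA mxE.
have At0 : \det (A t) != 0 by rewrite unitmxE unitfE in At.
have := cdiff_cvg (cdiff_det Ad) => /(cvg_neq0 At0) An0.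
move=> i; case: (ltngtP i m) => im; last first.
- subst i; apply: near_cdiff (cdiff_cst 1 t).
  by apply: filterS qs => s [/monicP + sq _]; rewrite lead_coefE sq.
- apply: near_cdiff (cdiff_cst 0 t).
  by apply: filterS qs => s [_ sq _]; rewrite nth_default // sq.
have : cdiff (fun s => (B s *m invmx (A s)) 0 (Ordinal im)) t.
  under eq_fun do rewrite mxE.
  by apply: cdiff_sum => k _; apply: cdiffM => //; exact: cdiff_invmx.
apply: near_cdiff; apply: filterS2 qs An0 => s [qmon sq qo] ds0.
have -> : B s = poly_rV (q s) *m A s.
  apply/rowP => k; rewrite mulA mxE; apply/eqP.
  rewrite eq_sym -subr_eq0 opprK -big_split /= -[X in _ == X](qo k (ltn_ord k)).
  apply/eqP/eq_bigr => j _; rewrite -mulrDl -mulrDr; congr (_ * _ * _).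
  rewrite (horner_coef_wide _ (size_poly _ _)) [in RHS]horner_coef sq big_ord_recr /=.
  have -> : (q s)`_m = 1 by move/monicP: qmon; rewrite lead_coefE sq.
  rewrite mul1r; congr (_ + _); apply: eq_bigr => l _.
  by rewrite coef_rVpoly_ord mxE.
by rewrite mulmxK ?mxE // unitmxE unitfE.
Qed.

(** Synthetic division: G_i = p_(i+1) + x G_(i+1), starting from the top. *)
Lemma cdiff_factor_coef (M : nat) (x : R -> R[i]) (p G : R -> {poly R[i]}) (t : R) :
  cdiff x t -> (forall i, cdiff (fun s => (p s)`_i) t) ->
  (\forall s \near t, (size (p s) <= M)%N /\ p s = ('X - (x s)%:P) * G s) ->
  forall i, cdiff (fun s => (G s)`_i) t.
Proof.
move=> xd pd pG i; have [k] := ubnP (M - i); elim: k i => // k IH i Mik.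
have [Mi|iM] := leqP M i.
  apply: near_cdiff (cdiff_cst 0 t); apply: filterS pG => s [sp pE].
  rewrite nth_default //; apply: leq_trans Mi; apply: leq_trans sp.
  have [->|G0] := eqVneq (G s) 0; first by rewrite size_poly0.
  by rewrite pE size_monicM ?monicXsubC // size_XsubC.
have : cdiff (fun s => (p s)`_i.+1 + x s * (G s)`_i.+1) t.
  apply: cdiffD => //; apply: cdiffM => //; apply: IH.
  by rewrite subnS; case: (M - i)%N (subn_gt0 i M) Mik => //; rewrite iM.
apply: near_cdiff; apply: filterS pG => s [_ ->].
by rewrite mulrBl coefB coefXM coefCM subrK.
Qed.

Lemma cdiff_horner (M : nat) (x : R -> R[i]) (p : R -> {poly R[i]}) (t : R) :
  cdiff x t -> (forall i, cdiff (fun s => (p s)`_i) t) ->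
  (\forall s \near t, (size (p s) <= M)%N) ->
  cdiff (fun s => (p s).[x s]) t.
Proof.
move=> xd pd sp; have : cdiff (fun s => \sum_(i < M) (p s)`_i * x s ^+ i) t.
  by apply: cdiff_sum => i _; apply: cdiffM => //; exact: cdiffX.
by apply: near_cdiff; apply: filterS sp => s /horner_coef_wide ->.
Qed.
End Gram.

(** * Following a simple zero *)

Section Divdiff.
Variable C : fieldType.
Implicit Types (p : {poly C}) (x y : C).

Definition divdiff M p x y : C :=
  \sum_(i < M) p`_i * \sum_(k < i) x ^+ (i.-1 - k) * y ^+ k.

Lemma horner_divdiff M p x y : (size p <= M)%N ->
  p.[x] - p.[y] = (x - y) * divdiff M p x y.
Proof.
move=> sp; rewrite !(horner_coef_wide _ sp) -sumrB big_distrr.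
by apply: eq_bigr => i _ /=; rewrite -mulrBr subrXX mulrCA.
Qed.

(** As a polynomial in its second argument, the divided difference at the root x
    is the cofactor of (X - x) in p. *)
Lemma divdiff_simple_root M p x : (size p <= M)%N -> root p x ->
  ~~ (('X - x%:P) * ('X - x%:P) %| p) -> divdiff M p x x != 0.
Proof.
move=> sp px; apply: contraNneq => Dx.
pose E := \sum_(i < M) (p`_i)%:P * \sum_(k < i) x%:P ^+ (i.-1 - k) * 'X ^+ k.
have : (p.[x])%:P - p = (x%:P - 'X) * E.
  rewrite (horner_coef_wide _ sp) rmorph_sum.
  have {2}-> : p = \sum_(i < M) (p`_i)%:P * 'X^i.
    rewrite -[LHS](take_poly_id sp) /take_poly poly_def.
    by apply: eq_bigr => i _; rewrite mul_polyC.
  rewrite -sumrB big_distrr; apply: eq_bigr => i _ /=.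
  by rewrite rmorphM rmorphXn /= -mulrBr subrXX mulrCA.
rewrite (rootP px) sub0r => /(congr1 -%R); rewrite opprK -mulNr opprB => pE.
rewrite pE dvdp_mul2l ?polyXsubC_eq0 // dvdp_XsubCl; apply/rootP.
rewrite -[RHS]Dx /E horner_sum; apply: eq_bigr => i _.
rewrite hornerM hornerC horner_sum; congr (_ * _); apply: eq_bigr => k _.
by rewrite hornerM !horner_exp hornerC hornerX.
Qed.

End Divdiff.

Section Branch.
Variable R : realType.
Implicit Types (p : R -> {poly R[i]}) (t : R) (x y : R[i]).

Lemma cvg_exprn {T : Type} {F : set_system T} {FF : Filter F}
  (f : T -> R[i]^o) (l : R[i]^o) (n : nat) :
  f @ F --> l -> (fun s => (f s ^+ n : R[i]^o)) @ F --> (l ^+ n : R[i]^o).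
Proof.
move=> fl; elim: n => [|n IH]; first exact: cvg_cst.
by under eq_fun do rewrite exprS; rewrite exprS; exact: (cvgM fl IH).
Qed.

Lemma cvg_bigsum {T I : Type} {F : set_system T} {FF : Filter F} (r : seq I)
  (f : I -> T -> R[i]^o) (l : I -> R[i]^o) :
  (forall i, f i @ F --> l i) ->
  (fun s => (\sum_(i <- r) f i s : R[i]^o)) @ F --> (\sum_(i <- r) l i : R[i]^o).
Proof.
move=> fl; elim: r => [|i r IH].
  by under eq_fun do rewrite big_nil; rewrite big_nil; exact: cvg_cst.
by under eq_fun do rewrite big_cons; rewrite big_cons; exact: (cvgD (fl i) IH).
Qed.

Lemma cvg_divdiff {T : Type} {F : set_system T} {FF : Filter F} M
  (p : T -> {poly R[i]}) (q : {poly R[i]}) (f g : T -> R[i]^o) (x y : R[i]^o) :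
  (forall i, (fun s => ((p s)`_i : R[i]^o)) @ F --> (q`_i : R[i]^o)) ->
  f @ F --> x -> g @ F --> y ->
  (fun s => (divdiff M (p s) (f s) (g s) : R[i]^o)) @ F -->
  (divdiff M q x y : R[i]^o).
Proof.
move=> pq fx gy; rewrite /divdiff; apply: (@cvg_bigsum T 'I_M F FF _
  (fun i s => (p s)`_i * \sum_(k < i) f s ^+ (i.-1 - k) * g s ^+ k)
  (fun i => q`_i * \sum_(k < i) x ^+ (i.-1 - k) * y ^+ k)) => i.
apply: (cvgM (pq i)); apply: (@cvg_bigsum T 'I_i F FF _
  (fun k s => f s ^+ (i.-1 - k) * g s ^+ k)
  (fun k => x ^+ (i.-1 - k) * y ^+ k)) => k.
exact: (cvgM (@cvg_exprn _ _ _ f x (i.-1 - k) fx) (@cvg_exprn _ _ _ g y k gy)).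

Qed.

(** Two distinct roots y and z of p s annihilate the divided difference, which is
    continuous in (s, y, z) and nonzero at (t, x, x). *)
Lemma near_unique_root M p t x :
  (forall i, cdiff (fun s => (p s)`_i) t) ->
  (\forall s \near t, (size (p s) <= M)%N) ->
  divdiff M (p t) x x != 0 ->
  exists2 d : R, 0 < d & \forall s \near t, forall y z,
    `|y - x| < d%:C -> `|z - x| < d%:C ->
    root (p s) y -> root (p s) z -> y = z.
Proof.
move=> pd sp D0.
pose Fx := filter_prod (nbhs (x : R[i]^o)) (nbhs (x : R[i]^o)).
pose F := filter_prod (nbhs t) Fx.
have : \forall u \near F, divdiff M (p u.1) u.2.1 u.2.2 != 0.
  apply: (cvg_neq0 D0); apply: cvg_divdiff.
  - move=> i; apply: (@cvg_comp _ _ _ fst (fun s => (p s)`_i : R[i]^o) F (nbhs t)).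
      exact: cvg_fst.
    exact: (cdiff_cvg (pd i)).
  - apply: (@cvg_comp _ _ _ snd fst F Fx).
      exact: cvg_snd.
    exact: cvg_fst.
  - apply: (@cvg_comp _ _ _ snd snd F Fx).
      exact: cvg_snd.
    exact: cvg_snd.
move=> [[A B] /= [tA [[B1 B2] /= [xB1 xB2] B12]] AB].
have /nbhs_ballP[e /= e0 eB] : nbhs (x : R[i]^o) (B1 `&` B2) by exact: filterI.
have [d ed] : exists d : R, e = d%:C by apply/complex_realP; exact: gtr0_real.
exists d; first by rewrite -ltcR -ed.
near=> s => y z yx zx py pz.
have sub v : `|v - x| < d%:C -> (B1 `&` B2) v.
  by move=> vx; apply: eB; rewrite -ball_normE /= ed distrC.
have : divdiff M (p s) y z != 0.
  apply: (AB (s, (y, z))); split => /=; first by near: s.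
  by apply: B12; split => /=; [have [] := sub y yx|have [] := sub z zx].
have sps : (size (p s) <= M)%N by near: s.
have := horner_divdiff y z sps; rewrite (rootP py) (rootP pz) subrr => /esym/eqP.
by rewrite mulf_eq0 subr_eq0 => /orP[/eqP //|->].
Unshelve. all: by end_near. Qed.

(** |p s (x)| is the product of the n distances from x to the roots of p s; if
    they were all at least d, it would be at least d^n. *)
Lemma near_exists_root n p t x (d : R[i]) :
  (forall i, cdiff (fun s => (p s)`_i) t) ->
  (\forall s \near t, p s \is monic /\ size (p s) = n.+1) ->
  root (p t) x -> 0 < d ->
  \forall s \near t, exists2 y, root (p s) y & `|y - x| < d.
Proof.
move=> pd ps px d0.
have sp : \forall s \near t, (size (p s) <= n.+1)%N.
  by apply: filterS ps => s [_ ->].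
have /cdiff_cvg/cvgrPdist_lt : cdiff (fun s => (p s).[x]) t.
  by apply: cdiff_horner sp => //; exact: cdiff_cst.
move=> /(_ (d ^+ n)); rewrite exprn_gt0 // => /(_ isT).
rewrite (rootP px); apply: filterS2 ps => s [mon sz]; rewrite sub0r normrN.
have [rs rsE] := closed_field_poly_normal (p s).
move: rsE; rewrite (monicP mon) scale1r => rsE.
have nrs : size rs = n by apply: succn_inj; rewrite -sz rsE size_prod_XsubC.
have [/hasP[y yrs yx] _|/hasPn far] := boolP (has (fun y => `|y - x| < d) rs).
  by exists y => //; rewrite rsE root_prod_XsubC.
suff le : d ^+ n <= `|(p s).[x]| by move/(le_lt_trans le); rewrite ltxx.
have -> : d ^+ n = \prod_(y <- rs) d.
  by rewrite -nrs big_const_seq count_predT iter_mulr_1.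
rewrite rsE horner_prod normr_prod big_seq [leRHS]big_seq; apply: ler_prod => y yrs.
by rewrite ltW //= hornerXsubC distrC real_leNgt ?far // ?normr_real ?gtr0_real.
Qed.

Lemma near_eq_cvg_to {T : Type} {F : set_system T} {FF : Filter F}
  (f g : T -> R[i]^o) (l : R[i]^o) :
  (\forall s \near F, f s = g s) -> f @ F --> l -> g @ F --> l.
Proof. by move=> fg fl; apply: cvg_trans fl; exact: near_eq_cvg. Qed.

(** Since p_s(zeta_s) = 0 = p_t(zeta_t), the increment p_s(zeta_t) - p_t(zeta_t)
    is (zeta_t - zeta_s) times the divided difference of p_s at these two
    points. *)
Lemma cdiff_root M p t (zeta : R -> R[i]) :
  (forall i, cdiff (fun s => (p s)`_i) t) ->
  (\forall s \near t, (size (p s) <= M)%N /\ root (p s) (zeta s)) ->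
  (zeta : R -> R[i]^o) @ t --> (zeta t : R[i]^o) ->
  divdiff M (p t) (zeta t) (zeta t) != 0 ->
  cdiff zeta t.
Proof.
move=> pd pz zc D0.
have [l gl] : cdiff (fun s => (p s).[zeta t]) t.
  apply: (cdiff_horner (M := M)) => //; first exact: cdiff_cst.
  by apply: filterS pz => s [].
have sh : (fun h : R => h + t) @ 0^' --> t.
  apply: cvg_trans (cvg_app _ (@nbhs_dnbhs _ (0:R))) _.
  rewrite -[X in _ --> X](add0r t); apply: cvgD; [exact: cvg_id|exact: cvg_cst].
pose D s := divdiff M (p s) (zeta t) (zeta s).
have Dc : (D : R -> R[i]^o) @ t --> (D t : R[i]^o).
  exact: (@cvg_divdiff _ _ _ M p (p t) (fun=> zeta t) zeta _ _
    (fun i => cdiff_cvg (pd i)) (cvg_cst _) zc).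
have Dn0 : \forall s \near t, D s != 0 by exact: (cvg_neq0 D0 Dc).
exists (- (l / D t)); apply/is_cderive_quotP.
have Dinv : (fun h => (D (h + t))^-1 : R[i]^o) @ 0^' --> ((D t)^-1 : R[i]^o).
  have Dsh : (fun h => D (h + t) : R[i]^o) @ 0^' --> (D t : R[i]^o).
    by move=> A /Dc/sh.
  exact: (@cvgV R[i] _ _ _ (fun h => D (h + t) : R[i]^o) (D t) D0 Dsh).
have /is_cderive_quotP glq := gl.
have near_sh (A : set R) : (\forall s \near t, A s) -> \forall h \near 0^', A (h + t).
  exact: sh.
have [_ pz0] := nbhs_singleton pz.
apply: (near_eq_cvg_to _ (cvgN (cvgM glq Dinv))).
apply: filterS2 (near_sh _ pz) (near_sh _ Dn0) => h [sph rh] Dh.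
have := horner_divdiff (zeta t) (zeta (h + t)) sph.
rewrite (rootP rh) (rootP pz0) subr0 -/(D (h + t)) => E.
transitivity (- ((h^-1)%:C * (p (h + t)).[zeta t] * (D (h + t))^-1)).
  by rewrite [LHS]/(- (_ * _)) /= subr0.
by rewrite E mulrA mulfK // -mulrN opprB.
Qed.
End Branch.

(** * The branch through a zero of a paraorthogonal polynomial *)

Section Existence.
Variable R : realType.

(** Off the circle, x and 1 / conj x would be two distinct zeros. *)
Lemma popuc_root_unit (N : nat) (gamma omega : 'I_N.+1 -> R) n b P (x : R[i]) :
  (forall j, 0 <= gamma j) -> injective (fun j => expi (omega j)) ->
  (n <= #|[pred j | (0 < gamma j)%R]|)%N -> (0 < n)%N -> `|b| = 1 ->
  is_popuc gamma omega n b P -> root P x ->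
  `|x| = 1 /\ ~~ (('X - x%:P) * ('X - x%:P) %| P).
Proof.
move=> g0 inj nA n0 b1 popP Px.
have x0 : x != 0 by apply: contraTneq Px => ->; exact: popuc_root_neq0 popP n0 b1.
have simple := popuc_simple g0 inj nA n0 popP x0.
have xE : x = (x^*)^-1.
  apply: contraNeq simple => xx; rewrite Gauss_dvdp ?dvdp_XsubCl ?Px.
    exact: popuc_root_inv popP n0 b1 Px.
  by rewrite coprimep_XsubC2 // subr_eq0 eq_sym.
split; last by rewrite -xE in simple.
apply/eqP; rewrite -(@eqrXn2 _ 2) // expr1n normCK; apply/eqP.
by rewrite {1}xE mulVf // conjC_eq0.
Qed.

(** Each coefficient of P is a polynomial in conj b, the coefficients of Q_(n-1)
    and their conjugates. *)
Lemma cdiff_popuc_coef (J : set R) (N n : nat) (gamma omega : 'I_N.+1 -> R -> R)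
    (b : R -> R[i]) (P : R -> {poly R[i]}) (t : R) :
  open J -> J t ->
  (forall j s, J s -> 0 <= gamma j s) ->
  (forall j, derivable (gamma j) t 1) -> (forall j, derivable (omega j) t 1) ->
  injective (fun j => expi (omega j t)) ->
  (n <= #|[pred j | (0 < gamma j t)%R]|)%N -> (0 < n)%N -> cdiff b t ->
  (forall s, J s -> is_popuc (gamma^~ s) (omega^~ s) n (b s) (P s)) ->
  forall i, cdiff (fun s => (P s)`_i) t.
Proof.
move=> Jo Jt g0 gd od inj nA n0 bd popP.
have [Q QP] : {Q : R -> nat -> {poly R[i]} & forall s, J s ->
    is_opuc (gamma^~ s) (omega^~ s) n (Q s) /\
    P s = 'X * Q s n.-1 - ((b s)^*)%:P * revconj n.-1 (Q s n.-1)}.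
  apply: (@choice _ _ (fun s Q => J s ->
    is_opuc (gamma^~ s) (omega^~ s) n Q /\
    P s = 'X * Q n.-1 - ((b s)^*)%:P * revconj n.-1 (Q n.-1))) => s.
  have [Js|nJs] := pselect (J s); last by exists (fun=> 0).
  by have [Q] := popP s Js; exists Q.
have Jn : \forall s \near t, J s by exact: open_nbhs_nbhs.
have nn : (n.-1 < n)%N by rewrite prednK.
have Qd i : cdiff (fun s => (Q s n.-1)`_i) t.
  apply: (@cdiff_orthogonal_coef R N.+1 n.-1 (fun j s => (gamma j s)%:C)
    (fun j s => expi (omega j s))).
  - by move=> j; exact: cdiff_real.
  - by move=> j; apply: cdiff_expi.
  - apply: filterS Jn => s Js; have [opQ _] := QP s Js.
    have [Qm Qs _ _] := opQ _ nn; split=> // k kn.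
    have := @opuc_orthogonal _ _ _ _ n (Q s) n.-1 'X^k opQ nn.
    rewrite size_polyXn => /(_ kn) H; rewrite -[RHS]H; apply: eq_bigr => j _.
    by rewrite hornerXn mulrA.
  - move=> d sd; apply: (moments_nondegenerate (A := [pred j | (0 < gamma j t)%R])) => //.
      exact: leq_trans (leq_pred _) nA.
    by move=> j /=; exact: g0.
move=> i; have : cdiff (fun s => (if i == 0 then 0 else (Q s n.-1)`_i.-1) -
    (b s)^* * (if (i < n.-1.+1)%N then ((Q s n.-1)`_(n.-1 - i))^* else 0)) t.
  apply: cdiffB; first by case: eqP => // _; exact: cdiff_cst.
  apply: cdiffM; first exact: cdiff_conj.
  by case: (i < n.-1.+1)%N; [exact: cdiff_conj|exact: cdiff_cst].
apply: near_cdiff; apply: filterS Jn => s Js; have [_ ->] := QP s Js.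
by rewrite coefB coefXM coefCM coef_poly.
Qed.

(** The branch picks the only root in the disk of radius delta.  Its continuity at
    a later time t comes from [near_exists_root] there: a root close to zeta t is
    still in the disk, so it is the chosen one. *)
Lemma exists_unique_branch (J : set R) (P : R -> {poly R[i]}) (n : nat) (t0 : R)
    (zeta0 : R[i]) :
  open J -> J t0 ->
  (forall t, J t -> P t \is monic /\ size (P t) = n.+1) ->
  (forall t i, J t -> cdiff (fun s => (P s)`_i) t) ->
  (forall t x, J t -> root (P t) x ->
     `|x| = 1 /\ ~~ (('X - x%:P) * ('X - x%:P) %| P t)) ->
  root (P t0) zeta0 ->
  exists eps delta : R,
    exists2 zeta : R -> R[i], zero_branch J P t0 zeta0 eps delta zeta &
      forall zeta' : R -> R[i], zero_branch J P t0 zeta0 eps delta zeta' ->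
        forall t, ball t0 eps t -> zeta' t = zeta t.
Proof.
move=> Jo J0 Pms Pd Proot rt0.
have near_ms t : J t -> \forall s \near t, P s \is monic /\ size (P s) = n.+1.
  by move=> Jt; apply: (filterS Pms); exact: open_nbhs_nbhs.
have near_sz t : J t -> \forall s \near t, (size (P s) <= n.+1)%N.
  by move=> /near_ms; apply: filterS => s [_ ->].
have D0 t x : J t -> root (P t) x -> divdiff n.+1 (P t) x x != 0.
  move=> Jt Ptx; apply: divdiff_simple_root => //; first by have [_ ->] := Pms t Jt.
  by have [] := Proot t x Jt Ptx.
have [delta d0 uniq_near] :=
  near_unique_root (fun i => Pd t0 i J0) (near_sz t0 J0) (D0 _ _ J0 rt0).
have dC : 0 < delta%:C by rewrite ltcR.
have ex_near := near_exists_root (fun i => Pd t0 i J0) (near_ms t0 J0) rt0 dC.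
have Jn : \forall s \near t0, J s by exact: open_nbhs_nbhs.
have all_near := filterI Jn (filterI uniq_near ex_near).
have [eps /= e0 eb] := (nbhs_ballP _ _).1 (all_near _ _).
have bJ s : ball t0 eps s -> J s by move=> /eb[].
have [zeta zetaP] : {zeta : R -> R[i] & forall s, ball t0 eps s ->
    root (P s) (zeta s) /\ `|zeta s - zeta0| < delta%:C}.
  apply: (@choice _ _ (fun s y => ball t0 eps s ->
    root (P s) y /\ `|y - zeta0| < delta%:C)) => s.
  have [/eb[_ [_ [y ? ?]]]|nb] := pselect (ball t0 eps s); first by exists y.
  by exists 0.
have zeta_uniq s y : ball t0 eps s -> root (P s) y -> `|y - zeta0| < delta%:C ->
    y = zeta s.
  move=> bs ry yd; have [rz zd] := zetaP s bs; have [_ [us _]] := eb s bs.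
  exact: us.
exists eps, delta, zeta; last first.
  move=> zeta' [_ _ _ _ zP] t bt; have [[zd _] _ rz] := zP t bt.
  exact: zeta_uniq.
have bt0 : ball t0 eps t0 by exact: ballxx.
split=> //.
  by symmetry; apply: zeta_uniq; rewrite ?subrr ?normr0.
move=> t bt; have [rt zd] := zetaP t bt; have Jt := bJ t bt.
split=> //; first by split=> //; have [] := Proot t _ Jt rt.
apply/cderivableP; apply: (@cdiff_root R n.+1 P) => //.
- by move=> i; exact: Pd.
- have bn : \forall s \near t, ball t0 eps s.
    by apply: open_nbhs_nbhs; split => //; exact: ball_open.
  by apply: filterS2 bn (near_sz t Jt) => s bs; split=> //; have [] := zetaP s bs.
- apply/cvgrPdist_lt => e e0'.
  have [m m0 [me md]] : exists2 m : R[i], 0 < m &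
      m <= e /\ m <= delta%:C - `|zeta t - zeta0|.
    have r0 : 0 < delta%:C - `|zeta t - zeta0| by rewrite subr_gt0.
    have [er|/ltW re] := real_leP (gtr0_real e0') (gtr0_real r0); first by exists e.
    by exists (delta%:C - `|zeta t - zeta0|).
  have ex_t := near_exists_root (fun i => Pd t i Jt) (near_ms t Jt) rt m0.
  have bn : \forall s \near t, ball t0 eps s.
    by apply: open_nbhs_nbhs; split => //; exact: ball_open.
  apply: filterS2 bn ex_t => s bs [y ry].
  move=> ym; rewrite -(zeta_uniq s y) //.
    by rewrite distrC; exact: lt_le_trans ym me.
  rewrite -(subrK (zeta t) y) -addrA (le_lt_trans (ler_normD _ _)) //.
  by rewrite -ltrBrDr; exact: lt_le_trans ym md.
exact: D0.
Qed.
End Existence.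

(** * Half-angle formulas *)

Section Trig.
Variable R : realType.
Implicit Types x y : R.

Lemma expiD x y : expi (x + y) = expi x * expi y.
Proof.
by rewrite /expi sinD cosD; apply/eqP; rewrite eq_complex /= [_ + cos x * _]addrC !eqxx.
Qed.

Lemma conj_expi x : (expi x)^* = expi (- x).
Proof. by rewrite /expi sinN cosN. Qed.

Lemma expiB_half x y :
  expi x - expi y = 2 * 'i%C * (sin ((x - y) / 2))%:C * expi ((x + y) / 2).
Proof.
have -> : expi x = expi ((x - y) / 2) * expi ((x + y) / 2).
  by rewrite -expiD; congr expi; field.
have -> : expi y = expi (- ((x - y) / 2)) * expi ((x + y) / 2).
  by rewrite -expiD; congr expi; field.
rewrite -mulrBl; congr (_ * _).
rewrite -conj_expi /expi; set c := cos _; set s := sin _.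
apply/eqP; rewrite eq_complex /=; apply/andP; split; apply/eqP; ring.
Qed.

(** The phase on the right is the same for all points exp(i w), which is what turns
    complex orthogonality relations into relations with a real kernel. *)
Lemma chord_product (w : R) x y :
  (expi w - expi x) * (expi w - expi y) * (expi w)^* =
  - 4 * (sin ((x - w) / 2) * sin ((y - w) / 2))%:C * expi ((x + y) / 2).
Proof.
have -> : expi ((x + y) / 2) =
    expi ((w + x) / 2) * expi ((w + y) / 2) * expi (- w).
  by rewrite -!expiD; congr expi; field.
rewrite !expiB_half conj_expi -(opprB x w) -(opprB y w) !mulNr !sinN.
rewrite rmorphM !rmorphN /=.
have i2 : 'i%C * 'i%C = -1 :> R[i] by rewrite -expr2 sqr_i.
set a := (sin _)%:C; set b := (sin _)%:C; set u := expi _; set v := expi _.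
set z := expi _.
transitivity (4 * ('i%C * 'i%C) * a * b * u * v * z); first by ring.
by rewrite i2; ring.
Qed.

Lemma sqr_norm_expiB x y :
  `|expi x - expi y| ^+ 2 = (4 * sin ((y - x) / 2) ^+ 2)%:C.
Proof.
have h0 : expi y * expi (- y) = 1 by rewrite -expiD subrr /expi cos0 sin0.
have := chord_product x y y; rewrite -mulrA -expr2 normCK rmorphB /= !conj_expi.
have hx : expi x * expi (- x) = 1 by rewrite -expiD subrr /expi cos0 sin0.
have -> : (y + y) / 2 = y by field.
move/(congr1 (fun z => - expi (- y) * z)) => E.
transitivity (- expi (- y) * ((expi x - expi y) * ((expi x - expi y) * expi (- x)))).
  have -> : (expi x - expi y) * expi (- x) = expi y * (expi (- y) - expi (- x)).
    by rewrite mulrBl mulrBr hx h0.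
  transitivity ((expi y * expi (- y)) *
    ((expi x - expi y) * (expi (- x) - expi (- y)))).
    by rewrite h0 mul1r.
  ring.
rewrite E expr2 [in RHS]rmorphM /= rmorphM /=.
transitivity (4 * ((sin ((y - x) / 2))%:C * (sin ((y - x) / 2))%:C) *
  (expi y * expi (- y))).
  ring.
by rewrite h0 mulr1 rmorph_nat.
Qed.

Lemma sin_half_neq0 x y : expi x != expi y -> sin ((y - x) / 2) != 0.
Proof.
apply: contraNneq => s0; rewrite -subr_eq0 -normr_eq0 -sqrf_eq0 sqr_norm_expiB.
by rewrite s0 expr0n mulr0.
Qed.

Lemma Re_1Bexpi x : complex.Re (1 - expi x) = 2 * sin (x / 2) ^+ 2.
Proof.
rewrite ReB /= [in cos x](_ : x = x / 2 + x / 2); last by field.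
by rewrite cosD -!expr2 cos2sin2; ring.
Qed.
End Trig.

Section Lift.
Variable R : realType.

(** Near t, phi s - phi t is the arcsine of the imaginary part of
    zeta s * conj (zeta t). *)
Lemma derivable_argument (zeta : R -> R[i]) (phi : R -> R) t :
  cdiff zeta t -> {for t, continuous phi} ->
  (\forall s \near t, zeta s = expi (phi s)) -> derivable phi t 1.
Proof.
move=> zd phic zE.
have [l [_ ud]] : cdiff (fun s => zeta s * (zeta t)^*) t.
  by apply: cdiffM => //; exact: cdiff_cst.
have zt := nbhs_singleton zE.
have ut : complex.Im (zeta t * (zeta t)^*) = 0.
  by rewrite zt conj_expi -expiD subrr /expi /= sin0.
have asd : is_derive (complex.Im (zeta t * (zeta t)^*)) 1 (@asin R)
    (Num.sqrt (1 - 0 ^+ 2))^-1.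
  by rewrite ut; apply: is_derive1_asin; rewrite ltrN10 ltr01.
have dd := is_deriveD (is_derive_cst (phi t) t 1) (is_derive1_comp asd ud).
have := @ex_derive _ _ _ _ _ _ _ dd; apply: near_eq_derivable.
have pi2 : 0 < pi / 2 :> R by rewrite divr_gt0 ?pi_gt0.
have /cvgrPdist_lt/(_ _ pi2) pc := phic.
apply: filterS2 pc zE => s ps zs.
rewrite !fctE /= zs zt conj_expi -expiD /expi /= sinK ?subrKC //.
by rewrite in_itv /= -ler_norml distrC ltW.
Qed.
End Lift.

Section SinSquares.
Variable R : realType.

Lemma is_derive_sin_half (phi w : R -> R) (t dphi dw : R) :
  is_derive t 1 phi dphi -> is_derive t 1 w dw ->
  is_derive t 1 (fun s => sin ((phi s - w s) / 2))
    (cos ((phi t - w t) / 2) * ((dphi - dw) / 2)).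
Proof.
move=> dp dwt.
have d1 : is_derive t 1 (fun s => (phi s - w s) / 2) ((dphi - dw) / 2).
  have := is_deriveM (is_deriveB dp dwt) (is_derive_cst (2^-1 : R) t 1).
  by move/is_derive_eq; apply; rewrite /GRing.scale /=; ring.
exact: (is_derive1_comp (is_derive_sin _) d1).
Qed.

Lemma is_derive_prod_sin_sqr (r : seq nat) (c : nat -> R) (w : R -> R) (t dw : R) :
  is_derive t 1 w dw ->
  (forall k, k \in r -> sin ((c k - w t) / 2) != 0) ->
  is_derive t 1 (fun s => \prod_(k <- r) sin ((c k - w s) / 2) ^+ 2)
    (- dw * (\sum_(k <- r) cot ((c k - w t) / 2)) *
       \prod_(k <- r) sin ((c k - w t) / 2) ^+ 2).
Proof.
move=> dwt; elim: r => [_|k r IH ne0].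
  under eq_fun do rewrite big_nil; rewrite !big_nil.
  by apply: is_derive_eq (is_derive_cst _ _ _) _; rewrite mulr0 mul0r.
under eq_fun do rewrite big_cons; rewrite !big_cons.
have dS := is_derive_sin_half (is_derive_cst (c k) t 1) dwt.
have d2 : is_derive t 1 (fun s => sin ((c k - w s) / 2) ^+ 2)
    (- dw * cot ((c k - w t) / 2) * sin ((c k - w t) / 2) ^+ 2).
  have := is_deriveM dS dS; move/is_derive_eq; apply.
  rewrite /GRing.scale /= /cot.
  by field; apply: ne0; rewrite inE eqxx.
have d3 := IH (fun i ir => ne0 i (@mem_behead _ (k :: r) i ir)).
have := is_deriveM d2 d3; move/is_derive_eq; apply.
rewrite /GRing.scale /=; ring.
Qed.
End SinSquares.

(** * Motion of a zero when another one is fixed *)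

Section Motion.
Variables (R : realType) (N m : nat) (U : set R) (t : R).
Variables (gamma omega : 'I_N.+1 -> R -> R) (b : R -> R[i]) (P : R -> {poly R[i]}).
Variables (zeta : R -> R[i]) (theta0 : R) (phi : nat -> R -> R).
Hypotheses (U_open : open U) (Ut : U t).
Hypothesis gamma_ge0 : forall j s, U s -> 0 <= gamma j s.
Hypothesis gamma_diff : forall j, derivable (gamma j) t 1.
Hypothesis omega_diff : forall j, derivable (omega j) t 1.
Hypothesis masses_distinct : injective (fun j => expi (omega j t)).
Hypothesis support_ge : (m.+2 <= #|[pred j | (0 < gamma j t)%R]|)%N.
Hypothesis P_popuc : forall s, U s ->
  is_popuc (gamma^~ s) (omega^~ s) m.+2 (b s) (P s).
Hypothesis P_factor : forall s, U s ->
  P s = \prod_(1 <= k < m.+3) ('X - (expi (phi k s))%:P).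
Hypothesis phi_fixed : forall s, U s -> phi m.+1 s = theta0.
Hypothesis phi_moving : forall s, U s -> zeta s = expi (phi m.+2 s).
Hypothesis zeta_diff : cdiff zeta t.
Hypothesis phi_cont : {for t, continuous (phi m.+2)}.
Hypothesis omega_neq : forall j k, (1 <= k <= m.+2)%N ->
  expi (omega j t) != expi (phi k t).

Let U_near : \forall s \near t, U s.
Proof. exact: open_nbhs_nbhs. Qed.

Definition cofactor_poly s : {poly R[i]} :=
  \prod_(1 <= k < m.+1) ('X - (expi (phi k s))%:P).
Local Notation G := cofactor_poly.

(** The real factor in [chord_product], for the moving and the fixed zero. *)
Definition chord_kernel j s : R :=
  sin ((phi m.+2 s - omega j s) / 2) * sin ((theta0 - omega j s) / 2).
Local Notation K := chord_kernel.

Let P_split s : U s ->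
  P s = ('X - (expi theta0)%:P) * (('X - (zeta s)%:P) * G s).
Proof.
move=> Us; rewrite P_factor // big_nat_recr //= big_nat_recr //=.
rewrite phi_fixed // -phi_moving //.
by rewrite -/(G s); ring.
Qed.

Let size_G s : size (G s) = m.+1.
Proof. by rewrite size_prod_XsubC size_iota subn1. Qed.

Let chord_kernel_orthogonal s (q : {poly R[i]}) : U s -> (size q <= m.+1)%N ->
  \sum_j (gamma j s * K j s)%:C * (G s).[expi (omega j s)] *
    (q.[expi (omega j s)])^* = 0.
Proof.
move=> Us sq; have := popuc_orthogonal (P_popuc Us) (ltn0Sn _) sq.
set S := \sum_j _.
have -> : mass_integral (gamma^~ s) (omega^~ s)
    (fun z => (P s).[z] * (z * q.[z])^*) =
    - 4 * expi ((phi m.+2 s + theta0) / 2) * S.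
  rewrite big_distrr; apply: eq_bigr => j _ /=.
  rewrite P_split // !hornerM !hornerXsubC rmorphM /= phi_moving //.
  set z := expi _; set Gz := (G s).[z]; set qz := (q.[z])^*.
  transitivity ((gamma j s)%:C *
    ((z - expi (phi m.+2 s)) * (z - expi theta0) * z^*) * Gz * qz); first by ring.
  by rewrite chord_product -/(K j s) [in RHS]rmorphM /=; ring.
move/eqP; rewrite !mulf_eq0 (negPf (expi_neq0 _)) orbF oppr_eq0 pnatr_eq0 /=.
by move/eqP.
Qed.

(** After division by the fixed factor, the polynomial (z - zeta) G is orthogonal
    to 1, ..., z^m for the weight (1 - a conj z) dmu, whose real part is positive
    away from a.  Its coefficients therefore solve a nondegenerate linear system
    with differentiable entries, and those of G follow by division. *)
Let cdiff_cofactor i : cdiff (fun s => (G s)`_i) t.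
Proof.
pose a := expi theta0; pose p s := ('X - (zeta s)%:P) * G s.
have p_monic s : p s \is monic.
  by rewrite monicMl ?monicXsubC // monic_prod // => k _; exact: monicXsubC.
have size_p s : size (p s) = m.+2.
  by rewrite size_monicM ?monicXsubC ?size_XsubC ?size_G // -size_poly_eq0 size_G.
have pd k : cdiff (fun s => (p s)`_k) t.
  apply: (@cdiff_orthogonal_coef R N.+1 m.+1
    (fun j s => (gamma j s)%:C * (1 - a * (expi (omega j s))^*))
    (fun j s => expi (omega j s))).
  - move=> j; apply: cdiffM; first exact: cdiff_real.
    apply: cdiffB; first exact: cdiff_cst.
    apply: cdiffM; first exact: cdiff_cst.
    by apply: cdiff_conj; exact: cdiff_expi.
  - by move=> j; exact: cdiff_expi.
  - apply: filterS U_near => s Us; split=> // l lm.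
    have := @popuc_orthogonal _ _ _ _ _ _ _ 'X^l (P_popuc Us) (ltn0Sn _).
    rewrite size_polyXn => /(_ lm) H; rewrite -[RHS]H; apply: eq_bigr => j _.
    rewrite P_split // /p !hornerM !hornerXsubC hornerXn rmorphM /=.
    have := unit_mulJ (norm_expi (omega j s)); rewrite -/a.
    set z := expi _ => zz.
    have -> : 1 - a * z^* = (z - a) * z^* by rewrite mulrBl zz.
    by ring.
  move=> d sd; apply: (moments_nondegenerate (A := [pred j | (0 < gamma j t)%R])) => //.
  - exact: leq_trans support_ge.
  - move=> j; cbv beta; rewrite conj_expi -expiD Re_realM Re_1Bexpi.
    by rewrite mulr_ge0 ?gamma_ge0 // mulr_ge0 ?sqr_ge0.
  - move=> j gj; cbv beta; rewrite conj_expi -expiD Re_realM Re_1Bexpi.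
    rewrite mulr_gt0 // mulr_gt0 // exprn_even_gt0 //=.
    have := @omega_neq j m.+1; rewrite phi_fixed // ltnS leqnSn => /(_ isT).
    exact: sin_half_neq0.
apply: (cdiff_factor_coef (M := m.+2) (p := p) (x := zeta)) => //.
by apply: filterS U_near => s _; rewrite size_p.
Qed.

(** Up to the factor 4^m, the value of |G|^2 at the j-th mass point of time s, the
    zeros of G being those of time t. *)
Definition frozen_weight j s : R :=
  \prod_(1 <= k < m.+1) sin ((phi k t - omega j s) / 2) ^+ 2.

Let norm_cofactor j s :
  `|(G t).[expi (omega j s)]| ^+ 2 = (4 ^+ m * frozen_weight j s)%:C.
Proof.
rewrite horner_prod normr_prod -prodrXl.
under eq_bigr do rewrite hornerXsubC sqr_norm_expiB.
rewrite -(rmorph_prod _ (index_iota 1 m.+1)) /=; congr (_%:C).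
by rewrite big_split /= prodr_const_nat subn1.
Qed.

Definition frozen_sum s : R := \sum_j gamma j s * K j s * frozen_weight j s.

Let frozen_sumE s : (4 ^+ m * frozen_sum s)%:C =
  \sum_j (gamma j s * K j s)%:C * (G t).[expi (omega j s)] *
    ((G t).[expi (omega j s)])^*.
Proof.
rewrite big_distrr rmorph_sum; apply: eq_bigr => j _ /=.
by rewrite -[RHS]mulrA -normCK norm_cofactor -rmorphM mulrCA.
Qed.

Lemma frozen_sum0 : frozen_sum t = 0.
Proof.
apply: (mulfI (_ : 4 ^+ m != 0)); first by rewrite expf_neq0 ?pnatr_eq0.
apply: (@complexI R); rewrite frozen_sumE mulr0.
by apply: chord_kernel_orthogonal; rewrite ?size_G.
Qed.

Let phi_diff : derivable (phi m.+2) t 1.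
Proof. by apply: derivable_argument zeta_diff phi_cont _; apply: filterS U_near. Qed.

Let chord_kernel_diff j : derivable (K j) t 1.
Proof.
have d1 := is_derive_sin_half (derivableP phi_diff) (derivableP (@omega_diff j)).
have d2 := is_derive_sin_half (is_derive_cst theta0 t 1) (derivableP (@omega_diff j)).
exact: (@ex_derive _ _ _ _ _ _ _ (is_deriveM d1 d2)).
Qed.

(** Replace one of the two frozen copies of G in the sum by the one of time s: the
    result is identically zero.  The difference is the sum over i of d_i(s) M_i(s),
    with d_i the i-th coefficient of G_t - G_s and M_i a moment that vanishes at
    t, so each product has derivative zero there. *)
Lemma is_derive_frozen_sum : is_derive t 1 frozen_sum 0.
Proof.
pose d i s := (G t)`_i - (G s)`_i.
pose M (i : nat) s := \sum_j (gamma j s * K j s)%:C *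
  ((G t).[expi (omega j s)])^* * expi (omega j s) ^+ i.
have dd i : cdiff (d i) t.
  by apply: cdiffB; [exact: cdiff_cst|exact: cdiff_cofactor].
have Md i : cdiff (M i) t.
  apply: cdiff_sum => j _; apply: cdiffM; last by apply: cdiffX; exact: cdiff_expi.
  apply: cdiffM.
    apply/cdiff_real/derivableM; first exact: gamma_diff.
    exact: chord_kernel_diff.
  apply/cdiff_conj/(cdiff_horner (M := m.+1)); first exact: cdiff_expi.
    by move=> k; exact: cdiff_cst.
  by apply: (@filterE _ (nbhs t)) => s; rewrite size_G.
have M0 i : (i < m.+1)%N -> M i t = 0.
  move=> im; apply: (can_inj conjCK); rewrite conjC0.
  have := @chord_kernel_orthogonal t 'X^i Ut; rewrite size_polyXn => /(_ im) H.
  rewrite -[RHS]H rmorph_sum; apply: eq_bigr => j _.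
  rewrite !rmorphM /= conjCK hornerXn !rmorphXn /=; congr (_ * _ * _).
  by rewrite -!rmorphM; apply: conj_Creal; apply/complex_realP; eexists.
have prod0 i : (i < m.+1)%N -> is_cderive (fun s => d i s * M i s) t 0.
  move=> im; have [u du] := dd i; have [v Mv] := Md i.
  apply: is_cderive_eq (is_cderiveM du Mv) _.
  by rewrite M0 // mulr0 addr0 /d subrr mul0r.
have sum0 : is_cderive (fun s => \sum_(i < m.+1) d i s * M i s) t 0.
  apply: is_cderive_sum0 => i; exact: prod0.
have [re _] : is_cderive (fun s => (4 ^+ m * frozen_sum s)%:C) t 0.
  apply: near_eq_is_cderive sum0; apply: filterS U_near => s Us.
  have sG : (size (G t) <= m.+1)%N by rewrite size_G.
  rewrite frozen_sumE -[RHS]subr0 -[X in _ = _ - X](chord_kernel_orthogonal Us sG).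
  rewrite -sumrB; under eq_bigr do rewrite /M big_distrr /=.
  rewrite exchange_big /=; apply: eq_bigr => j _.
  rewrite -mulrBl -mulrBr.
  rewrite !(@horner_coef_wide _ m.+1) ?size_G // -sumrB.
  rewrite mulrAC big_distrr; apply: eq_bigr => i _ /=; rewrite /d; ring.
have := is_deriveM (is_derive_cst ((4 ^+ m)^-1 : R) t 1) re.
rewrite /= /GRing.scale /= mulr0 mulr0 addr0.
have -> // : (cst (4 ^+ m)^-1 * (fun x => 4 ^+ m * frozen_sum x)) = frozen_sum.
by apply/funext => s; rewrite !fctE mulKf // expf_neq0 // pnatr_eq0.
Qed.

Let sin_moving_neq0 j : sin ((phi m.+2 t - omega j t) / 2) != 0.
Proof. by apply/sin_half_neq0/omega_neq; rewrite leqnn. Qed.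

Let sin_fixed_neq0 j : sin ((theta0 - omega j t) / 2) != 0.
Proof.
have := @omega_neq j m.+1; rewrite phi_fixed // ltnS leqnSn => /(_ isT).
exact: sin_half_neq0.
Qed.

Let S_weightE j : S_weight m.+2 (phi^~ t) (omega j t) =
  \sum_(1 <= k < m.+1) cot ((phi k t - omega j t) / 2) +
  cot ((theta0 - omega j t) / 2) / 2 +
  cot ((phi m.+2 t - omega j t) / 2) / 2.
Proof.
rewrite /S_weight big_nat_recr //= big_nat_recr //= !eqxx phi_fixed //.
rewrite (ltn_eqF (ltnSn m.+1)) eq_sym (ltn_eqF (ltnSn m.+1)) !addr0.
congr (_ + _ + _); try by rewrite [_^-1 * _]mulrC.
rewrite !big_nat; apply: eq_bigr => k /andP[_ km].
by rewrite !ltn_eqF ?(leqW km) // !addr0 invr1 mul1r.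
Qed.

Definition frozen_mass : R :=
  \sum_j gamma j t * frozen_weight j t * sin ((theta0 - omega j t) / 2) ^+ 2.

(** The derivative of the frozen sum is zero.  Multiplied by
    sg = sin((phi - theta0)/2), its terms in gamma' and omega' become multiples of
    W_j, by s_j = sg / (2 K_j) and because - S_j is the logarithmic derivative of
    K_j |G|^2 in omega_j.  In the term with phi',
    sg cos A sin B = cos(A - B) K - sin^2 B, and the multiple of K sums to
    zero. *)
Lemma velocity_formula :
  'D_1 (phi m.+2) t * frozen_mass =
  4 * \sum_j frozen_weight j t * K j t ^+ 2 *
        W_weight m.+2 theta0 phi (gamma j) (omega j) t.
Proof.
set v := 'D_1 (phi m.+2) t.
pose A j := (phi m.+2 t - omega j t) / 2; pose B j := (theta0 - omega j t) / 2.
pose T j := \sum_(1 <= k < m.+1) cot ((phi k t - omega j t) / 2).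
pose dg j := 'D_1 (gamma j) t; pose dw j := 'D_1 (omega j) t.
pose g j := frozen_weight j t.
(* X j is the derivative of the j-th term of the frozen sum *)
pose X j := dg j * K j t * g j
  + gamma j t * (cos (A j) * ((v - dw j) / 2) * sin (B j)
                 - sin (A j) * cos (B j) * (dw j / 2)) * g j
  - gamma j t * K j t * g j * T j * dw j.
have dX j : is_derive t 1 (fun s => gamma j s * K j s * frozen_weight j s) (X j).
  have dA := is_derive_sin_half (derivableP phi_diff) (derivableP (@omega_diff j)).
  have dB := is_derive_sin_half (is_derive_cst theta0 t 1) (derivableP (@omega_diff j)).
  have dG : is_derive t 1 (frozen_weight j) (- dw j * T j * g j).
    apply: is_derive_prod_sin_sqr => [|k]; first exact: (derivableP (@omega_diff j)).
    rewrite mem_index_iota => /andP[k1 km].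
    by apply/sin_half_neq0/omega_neq; rewrite k1 ltnW // ltnW.
  have := is_deriveM (is_deriveM (derivableP (@gamma_diff j)) (is_deriveM dA dB)) dG.
  move/is_derive_eq; apply.
  rewrite /GRing.scale /= /X /chord_kernel /cst -/v -/(A j) -/(B j).
  by rewrite !fctE -/(A j) -/(B j) -/(dw j) -/(dg j) -/(g j); ring.
have sumX : \sum_j X j = 0.
  have := is_derive_sum dX.
  have -> : \sum_j (fun s => gamma j s * K j s * frozen_weight j s) = frozen_sum.
    by apply/funext => s; rewrite fct_sumE.
  by case=> _ <-; case: is_derive_frozen_sum.
pose sg := sin ((phi m.+2 t - theta0) / 2); pose c := cos ((phi m.+2 t - theta0) / 2).
have AB j : (phi m.+2 t - theta0) / 2 = A j - B j by rewrite /A /B; field.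
have key j : 4 * (g j * K j t ^+ 2 * W_weight m.+2 theta0 phi (gamma j) (omega j) t) =
    2 * sg * X j + v * (gamma j t * g j * sin (B j) ^+ 2)
    - v * c * (gamma j t * K j t * g j).
  have sA : sin (A j) != 0 := sin_moving_neq0 j.
  have sB : sin (B j) != 0 := sin_fixed_neq0 j.
  rewrite /W_weight S_weightE /s_weight !derive1E -/(A j) -/(B j) -/(T j).
  rewrite -/(dg j) -/(dw j) -/sg /X /chord_kernel -/(A j) -/(B j) /cot.
  have -> : sg = sin (A j) * cos (B j) - cos (A j) * sin (B j).
    by rewrite /sg (AB j) sinB.
  have -> : c = cos (A j) * cos (B j) + sin (A j) * sin (B j).
    by rewrite /c (AB j) cosB.
  have sA2 := cos2sin2 (A j); have sB2 := cos2sin2 (B j).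
  move: sA sB sA2 sB2; move: (sin (A j)) (cos (A j)) (sin (B j)) (cos (B j)).
  move=> a a' bb b' a0 b0 aE bE.
  field: aE bE.
  by apply/andP.
rewrite [RHS]big_distrr /= (eq_bigr _ (fun j _ => key j)) sumrB big_split /=.
rewrite -!big_distrr /= sumX -/(frozen_sum t) frozen_sum0 !mulr0 add0r subr0.
by rewrite /frozen_mass.
Qed.

Lemma frozen_weight_gt0 j : 0 < frozen_weight j t.
Proof.
rewrite /frozen_weight big_nat; apply: prodr_gt0 => k /andP[k1 km].
rewrite exprn_even_gt0 //=; apply/sin_half_neq0/omega_neq.
by rewrite k1 ltnW // ltnW.
Qed.

Lemma frozen_mass_gt0 : 0 < frozen_mass.
Proof.
have [j gj] : exists j, 0 < gamma j t.
  by have /card_gt0P[j] := leq_trans (ltn0Sn _) support_ge; exists j.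
have ge0 i : 0 <= gamma i t * frozen_weight i t * sin ((theta0 - omega i t) / 2) ^+ 2.
  rewrite mulr_ge0 ?sqr_ge0 // mulr_ge0 ?gamma_ge0 //.
  by rewrite ltW // frozen_weight_gt0.
rewrite /frozen_mass (bigD1 j) //= ltr_pwDl ?sumr_ge0 //.
have s2 : 0 < sin ((theta0 - omega j t) / 2) ^+ 2.
  by rewrite exprn_even_gt0 ?sin_fixed_neq0 ?orbT.
by apply: mulr_gt0 s2; apply: mulr_gt0 gj _; exact: frozen_weight_gt0.
Qed.

Lemma moving_zero_velocity :
  [/\ derivable (phi m.+2) t 1,
      (forall j, 0 <= W_weight m.+2 theta0 phi (gamma j) (omega j) t) ->
      (exists j, W_weight m.+2 theta0 phi (gamma j) (omega j) t != 0) ->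
      0 < 'D_1 (phi m.+2) t &
      (forall j, W_weight m.+2 theta0 phi (gamma j) (omega j) t = 0) ->
      'D_1 (phi m.+2) t = 0].
Proof.
split=> [|W0 [j Wj]|W0]; first exact: phi_diff.
- rewrite -(pmulr_lgt0 _ frozen_mass_gt0) velocity_formula.
  have coef_gt0 i : 0 < frozen_weight i t * K i t ^+ 2.
    apply: mulr_gt0; first exact: frozen_weight_gt0.
    by rewrite exprn_even_gt0 // mulf_neq0 ?orbT ?sin_moving_neq0 ?sin_fixed_neq0.
  apply: mulr_gt0 => //; rewrite (bigD1 j) //= ltr_pwDl ?sumr_ge0 //.
    by rewrite mulr_gt0 // lt_def Wj W0.
  by move=> i _; rewrite mulr_ge0 // ltW.
apply: (mulIf (lt0r_neq0 frozen_mass_gt0)).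
by rewrite velocity_formula big1 ?mulr0 ?mul0r // => j _; rewrite W0 mulr0.
Qed.

End Motion.

Theorem theorem2p1 (R : realType) (J : set R) (t0 : R) (N n : nat)
    (gamma omega : 'I_N.+1 -> R -> R) (b : R -> R[i]) (P : R -> {poly R[i]})
    (zeta0 : R[i])
    (J_open : open J) (J_itv : is_interval J) (J_t0 : J t0)
    (gamma_ge0 : forall j t, J t -> 0 <= gamma j t)
    (gamma_diff : forall j t, J t -> derivable (gamma j) t 1)
    (omega_diff : forall j t, J t -> derivable (omega j) t 1)
    (masses_distinct : forall t, J t -> injective (fun j => expi (omega j t)))
    (support_ge : forall t, J t -> (n <= #|[pred j | (0 < gamma j t)%R]|)%N)
    (n_gt0 : (0 < n)%N)
    (b_unit : forall t, J t -> `|b t| = 1)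
    (P_popuc : forall t, J t ->
       is_popuc (gamma^~ t) (omega^~ t) n (b t) (P t))
    (P_zeta0 : root (P t0) zeta0) :
  ((forall t, J t -> cderivable b t) ->
   exists eps delta : R,
     exists2 zeta : R -> R[i], zero_branch J P t0 zeta0 eps delta zeta &
       forall zeta' : R -> R[i], zero_branch J P t0 zeta0 eps delta zeta' ->
         forall t, ball t0 eps t -> zeta' t = zeta t)
  /\
  (forall (eps delta : R) (zeta : R -> R[i]) (theta0 : R) (phi : nat -> R -> R),
     zero_branch J P t0 zeta0 eps delta zeta ->
     (forall t, ball t0 eps t -> root (P t) (expi theta0)) ->
     zeta0 != expi theta0 ->
     (forall t, ball t0 eps t ->
        P t = \prod_(1 <= k < n.+1) ('X - (expi (phi k t))%:P)) ->
     (forall t, ball t0 eps t -> phi n.-1 t = theta0) ->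
     (forall t, ball t0 eps t -> zeta t = expi (phi n t)) ->
     (forall t, ball t0 eps t -> {for t, continuous (phi n)}) ->
     (forall t, ball t0 eps t -> forall j k, (1 <= k <= n)%N ->
        expi (omega j t) != expi (phi k t)) ->
     ((forall t, ball t0 eps t ->
         (forall j, 0 <= W_weight n theta0 phi (gamma j) (omega j) t) /\
         (exists j, W_weight n theta0 phi (gamma j) (omega j) t != 0)) ->
      forall t1 t2, ball t0 eps t1 -> ball t0 eps t2 -> t1 < t2 ->
        phi n t1 < phi n t2)
     /\
     ((forall t, ball t0 eps t ->
         forall j, W_weight n theta0 phi (gamma j) (omega j) t = 0) ->
      forall t1 t2, ball t0 eps t1 -> ball t0 eps t2 -> zeta t1 = zeta t2)).
Proof.
have in_itv_ball eps t : (t \in `]t0 - eps, t0 + eps[) = (`|t - t0| < eps).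
  by rewrite in_itv /= ltr_distl.
have ballP eps t : ball t0 eps t <-> t \in `]t0 - eps, t0 + eps[.
  by rewrite in_itv_ball -ball_normE /= distrC.
split.
  move=> b_diff; apply: (@exists_unique_branch _ _ _ n) => // [t Jt|t i Jt|t x Jt Px].
  - exact: popuc_monic (P_popuc t Jt) n_gt0.
  - apply: (@cdiff_popuc_coef _ J N n gamma omega b) => //.
    + by move=> j; exact: gamma_diff.
    + by move=> j; exact: omega_diff.
    + exact: masses_distinct.
    + exact: support_ge.
    + by apply/cderivableP; exact: b_diff.
  - apply: (popuc_root_unit _ _ (support_ge t Jt) n_gt0 (b_unit t Jt)
      (P_popuc t Jt)) => //.
      by move=> j; exact: gamma_ge0.
    exact: masses_distinct.
move=> eps delta zeta theta0 phi [eps0 _ ballJ zeta_t0 zetaP] fixed_root zeta0_neq.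
move=> P_factor phi_fixed zetaE phi_cont omega_neq.
have bt0 : ball t0 eps t0 by exact: ballxx.
(* a polynomial of degree 1 cannot have the two zeros zeta0 and exp(i theta0) *)
have [m nE] : exists m, n = m.+2.
  case: n n_gt0 P_factor fixed_root
    {support_ge P_popuc phi_fixed zetaE phi_cont omega_neq} => // -[_ PE|m];
    last by exists m.
  move=> /(_ t0 bt0); move: P_zeta0; rewrite (PE t0 bt0) big_nat1.
  rewrite /root !hornerXsubC !subr_eq0 => /eqP zE /eqP aE.
  by case/eqP: zeta0_neq; rewrite zE aE.
subst n.
have velocity t : ball t0 eps t -> [/\ derivable (phi m.+2) t 1,
      (forall j, 0 <= W_weight m.+2 theta0 phi (gamma j) (omega j) t) ->
      (exists j, W_weight m.+2 theta0 phi (gamma j) (omega j) t != 0) ->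
      0 < 'D_1 (phi m.+2) t &
      (forall j, W_weight m.+2 theta0 phi (gamma j) (omega j) t = 0) ->
      'D_1 (phi m.+2) t = 0].
  move=> bt; have Jt := ballJ t bt.
  apply: (@moving_zero_velocity R N m (ball t0 eps) t gamma omega b P zeta theta0 phi).
  - exact: ball_open.
  - exact: bt.
  - by move=> j s bs; apply: gamma_ge0; exact: ballJ.
  - by move=> j; exact: gamma_diff.
  - by move=> j; exact: omega_diff.
  - exact: masses_distinct.
  - exact: support_ge.
  - by move=> s bs; apply: P_popuc; exact: ballJ.
  - exact: P_factor.
  - exact: phi_fixed.
  - exact: zetaE.
  - by apply/cderivableP; have [] := zetaP t bt.
  - exact: phi_cont.
  - exact: omega_neq.
split=> [W_pos t1 t2 b1 b2|W_null t1 t2 b1 b2].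
  apply: (@gtr0_derive1_lt_oo _ _ (t0 - eps) (t0 + eps)); try exact/ballP.
  - by move=> t /ballP bt; have [] := velocity t bt.
  - move=> t /ballP bt; have [W0 W1] := W_pos t bt.
    by rewrite derive1E; have [_ + _] := velocity t bt; apply.
  - by move=> t; rewrite inE => /ballP; exact: phi_cont.
rewrite (zetaE t1 b1) (zetaE t2 b2); congr expi.
wlog le12 : t1 t2 b1 b2 / t1 <= t2.
  by move=> H; have [/H|/ltW/H] := leP t1 t2; [apply|move=> ->].
have sub t : t1 <= t -> t <= t2 -> ball t0 eps t.
  move=> t1t tt2; apply/ballP; move/ballP: b1; move/ballP: b2.
  rewrite !in_itv /= => /andP[_ h2] /andP[h1 _].
  by rewrite (lt_le_trans h1) //= (le_lt_trans tt2).
have drv t : t \in `]t1, t2[ -> is_derive t 1 (phi m.+2) 0.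
  rewrite in_itv /= => /andP[t1t tt2].
  have bt : ball t0 eps t by apply: sub; exact: ltW.
  have [pd _ pz] := velocity t bt.
  by apply: DeriveDef => //; apply: pz; exact: W_null.
have cont : {within `[t1, t2], continuous (phi m.+2)}.
  apply: derivable_within_continuous => t; rewrite in_itv /= => /andP[t1t tt2].
  by have [] := velocity t (sub t t1t tt2).
have [c _ /eqP] := @MVT_segment R (phi m.+2) (fun=> 0) t1 t2 le12 drv cont.
by rewrite mul0r subr_eq0 => /eqP.
Qed.
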